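(* Let $(e^{tA})_{t\ge 0}$ be an individually eventually positive $C_0$-semigroup on a complex Banach lattice $E$. If $\sigma(A)\ne\emptyset$, then $s(A)\in\sigma(A)$.
   Context: A complex Banach lattice $E$ is the complexification of a real Banach lattice $E_{\mathbb{R}}$; $f\ge0$ means $f$ lies in the positive cone $E_+$ of $E_{\mathbb{R}}$. A $C_0$-semigroup $(e^{tA})_{t\ge0}$ with generator $A$ is individually eventually positive if for each $f\ge 0$ in $E$ there is $t_0\ge0$ such that $e^{tA}f\ge0$ for all $t\ge t_0$. $s(A)=\sup\{\operatorname{Re}\lambda:\lambda\in\sigma(A)\}$ is the spectral bound. *)

(* Defs.v *)
From Stdlib Require Import Reals.
From Coquelicot Require Import Coquelicot.

Local Open Scope R_scope.

Record RealBanachLattice := {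
  rbl_space :> CompleteNormedModule R_AbsRing;
  rbl_le : rbl_space -> rbl_space -> Prop;
  rbl_join : rbl_space -> rbl_space -> rbl_space;
  rbl_meet : rbl_space -> rbl_space -> rbl_space;
  rbl_le_refl : forall x, rbl_le x x;
  rbl_le_antisym : forall x y, rbl_le x y -> rbl_le y x -> x = y;
  rbl_le_trans : forall x y z, rbl_le x y -> rbl_le y z -> rbl_le x z;
  rbl_le_plus : forall x y z, rbl_le x y -> rbl_le (plus x z) (plus y z);
  rbl_le_scal : forall (a : R) x y,
    0 <= a -> rbl_le x y -> rbl_le (scal a x) (scal a y);
  rbl_join_ub_l : forall x y, rbl_le x (rbl_join x y);
  rbl_join_ub_r : forall x y, rbl_le y (rbl_join x y);
  rbl_join_least : forall x y z,
    rbl_le x z -> rbl_le y z -> rbl_le (rbl_join x y) z;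
  rbl_meet_lb_l : forall x y, rbl_le (rbl_meet x y) x;
  rbl_meet_lb_r : forall x y, rbl_le (rbl_meet x y) y;
  rbl_meet_greatest : forall x y z,
    rbl_le z x -> rbl_le z y -> rbl_le z (rbl_meet x y);
  rbl_norm_le : forall x y,
    rbl_le (rbl_join x (opp x)) (rbl_join y (opp y)) -> norm x <= norm y
}.

Arguments rbl_le {_} _ _.
Arguments rbl_join {_} _ _.
Arguments rbl_meet {_} _ _.

Definition is_supremum {V : RealBanachLattice} (P : V -> Prop) (m : V) : Prop :=
  (forall v, P v -> rbl_le v m) /\
  (forall b, (forall v, P v -> rbl_le v b) -> rbl_le m b).

(* The complexification of a real Banach lattice [cbl_real], presented
   internally: a complex Banach space E = E_R (+) i E_R, where E_R is the image
   of [cbl_emb], normed by || x + i y || = || |x + i y| || with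
   |x + i y| = sup_theta (cos theta x + sin theta y).  In a Banach lattice this
   supremum always exists, so the field [cbl_abs] is determined by the rest and
   carries no extra hypothesis. *)
Record ComplexBanachLattice := {
  cbl_real : RealBanachLattice;
  cbl_space :> CompleteNormedModule C_AbsRing;
  cbl_emb : cbl_real -> cbl_space;
  cbl_abs : cbl_space -> cbl_real;
  cbl_emb_plus : forall x y, cbl_emb (plus x y) = plus (cbl_emb x) (cbl_emb y);
  cbl_emb_scal : forall (a : R) x,
    cbl_emb (scal a x) = scal (RtoC a) (cbl_emb x);
  cbl_decomp : forall z : cbl_space, exists! p : cbl_real * cbl_real,
    z = plus (cbl_emb (fst p)) (scal Ci (cbl_emb (snd p)));
  cbl_abs_sup : forall x y : cbl_real,
    is_supremum
      (fun v => exists theta : R,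
         v = plus (scal (cos theta) x) (scal (sin theta) y))
      (cbl_abs (plus (cbl_emb x) (scal Ci (cbl_emb y))));
  cbl_norm_abs : forall z : cbl_space, norm z = norm (cbl_abs z)
}.

Arguments cbl_emb {_} _.
Arguments cbl_abs {_} _.

Definition nonneg {E : ComplexBanachLattice} (f : E) : Prop :=
  exists x : cbl_real E, rbl_le zero x /\ f = cbl_emb x.

(* [T t] is only meaningful for [0 <= t]. *)
Record is_C0_semigroup {E : CompleteNormedModule C_AbsRing}
    (T : R -> E -> E) : Prop := {
  c0_linear : forall t, 0 <= t -> is_linear (T t);
  c0_zero : forall f, T 0 f = f;
  c0_plus : forall s t f, 0 <= s -> 0 <= t -> T (s + t) f = T s (T t f);
  c0_continuous : forall f, filterlim (fun t => T t f) (at_right 0) (locally f)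
}.

(* Unbounded operators are given by their graphs: [A f g] means that [f] is in
   the domain of [A] and [A f = g]. *)
Definition generator {E : CompleteNormedModule C_AbsRing}
    (T : R -> E -> E) (f g : E) : Prop :=
  filterlim (fun t : R => scal (RtoC (/ t)) (minus (T t f) f))
    (at_right 0) (locally g).

(* [lambda - A] is a bijection from the domain of [A] onto [E] with a bounded
   inverse [S]. *)
Definition resolvent_set {E : CompleteNormedModule C_AbsRing}
    (A : E -> E -> Prop) (lambda : C) : Prop :=
  exists S : E -> E,
    is_linear S /\
    (forall h, exists g, A (S h) g /\ minus (scal lambda (S h)) g = h) /\
    (forall f g, A f g -> S (minus (scal lambda f) g) = f).

Definition spectrum {E : CompleteNormedModule C_AbsRing}
    (A : E -> E -> Prop) (lambda : C) : Prop := ~ resolvent_set A lambda.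

Definition spectral_bound {E : CompleteNormedModule C_AbsRing}
    (A : E -> E -> Prop) : Rbar :=
  Lub_Rbar (fun r => exists lambda : C, spectrum A lambda /\ r = Re lambda).

Definition individually_eventually_positive {E : ComplexBanachLattice}
    (T : R -> E -> E) : Prop :=
  forall f : E, nonneg f ->
    exists t0 : R, 0 <= t0 /\ forall t, t0 <= t -> nonneg (T t f).

(* Main.v *)
(* Call [g] orbit-positive when T(t) g >= 0 for all t >= 0; by eventual positivity
   every f >= 0 has some T(t0) f that is orbit-positive.  Let P be the set of real r
   in the resolvent set for which R(r) is nonnegative on orbit-positive vectors.

   If r is in P and g is orbit-positive, then
   R(r) g - int_0^b e^(-rt) T(t) g dt = e^(-rb) R(r) T(b) g >= 0, so these integrals
   increase and are bounded in norm by ||R(r) g||.  Hence for Re l > r the Laplace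
   integral of T at l converges on orbit-positive vectors, then on nonnegative ones
   (only an initial piece of the orbit is added), then everywhere; by uniform
   boundedness it is the resolvent at l.  So every spectral value has real part at
   most p := inf P, and P is nonempty because T grows at most exponentially.

   Finally p itself is a spectral value: otherwise the resolvents at r in P, r -> p+,
   would be uniformly bounded, and the Neumann series
   R(r - h) = sum_n h^n R(r)^(n+1), all of whose terms are nonnegative on
   orbit-positive vectors, would put points below p into P. *)

(* The obstacle is that the time [t0] depends on the vector, so no single [T t], and no resolvent,
   is known to preserve the cone of E. Orbit-positive vectors avoid this: they form a closed cone
   that is invariant under [T], and also under R(r) for r in P, because the resolvent commutes with
   [T]. This invariance keeps the Neumann iteration inside the cone.

   At a complex l the Laplace integral is not shown to converge absolutely: only the norm of int
   e^(-rt) T(t) g dt is controlled, not the integral of the norms. So the weight e^(-(l-r)t) is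
   split into real and imaginary parts, and each part is compared in the order of E before norms are
   taken.

   Nonemptiness of the spectrum enters once: a spectral value bounds P from below, so p is finite.
   Being a spectral value that dominates all real parts, p is then s(A).

   Integration, semigroups and uniform boundedness are treated over the reals, with E seen as a real
   Banach space. Complex scalars return through the semigroups e^(-lt) T(t) and the uniqueness of
   inverses. *)
Require Import Defs.
From Stdlib Require Import Reals Lra Lia List ClassicalEpsilon.
From Coquelicot Require Import Coquelicot.

Local Open Scope R_scope.

(** * Linear identities in modules *)

(* Reflection: both sides are read as formal combinations of a list of atoms, so that
   an identity reduces to the equality of the scalar coefficients. *)
Inductive mexpr (K : Type) :=
  | MVar (n : nat)
  | MZero
  | MPlus (a b : mexpr K)
  | MOpp (a : mexpr K)
  | MScal (k : K) (a : mexpr K).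

Arguments MVar {K} n.
Arguments MZero {K}.
Arguments MPlus {K} a b.
Arguments MOpp {K} a.
Arguments MScal {K} k a.

Fixpoint meval {K : Ring} {V : ModuleSpace K} (l : list V) (e : mexpr K) : V :=
  match e with
  | MVar n => nth n l zero
  | MZero => zero
  | MPlus a b => plus (meval l a) (meval l b)
  | MOpp a => opp (meval l a)
  | MScal k a => scal k (meval l a)
  end.

Fixpoint mcoef {K : Ring} (e : mexpr K) (n : nat) : K :=
  match e with
  | MVar m => if Nat.eqb m n then one else zero
  | MZero => zero
  | MPlus a b => plus (mcoef a n) (mcoef b n)
  | MOpp a => opp (mcoef a n)
  | MScal k a => mult k (mcoef a n)
  end.

Fixpoint mlin {K : Ring} {V : ModuleSpace K} (c : nat -> K) (l : list V) : V :=
  match l with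
  | nil => zero
  | cons x l => plus (scal (c 0%nat) x) (mlin (fun n => c (S n)) l)
  end.

(** Recursion on the atom list makes this compute to a finite conjunction of scalar equations, one
    per atom. *)
Fixpoint meq {K : Ring} {V : ModuleSpace K} (c d : nat -> K) (l : list V) : Prop :=
  match l with
  | nil => True
  | cons x l => c 0%nat = d 0%nat /\ meq (fun n => c (S n)) (fun n => d (S n)) l
  end.

Lemma mlin_ext {K : Ring} {V : ModuleSpace K} (l : list V) (c d : nat -> K) :
  meq c d l -> mlin c l = mlin d l.
Proof.
revert c d; induction l as [|x l IH]; intros c d; simpl; [easy|].
intros [-> H]; now rewrite (IH _ _ H).
Qed.

Lemma mlin_zero {K : Ring} {V : ModuleSpace K} (l : list V) :
  mlin (fun _ => zero : K) l = zero.
Proof.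
induction l as [|x l IH]; simpl; [easy|].
now rewrite IH, scal_zero_l, plus_zero_l.
Qed.

Lemma mlin_plus {K : Ring} {V : ModuleSpace K} (l : list V) (c d : nat -> K) :
  mlin (fun n => plus (c n) (d n)) l = plus (mlin c l) (mlin d l).
Proof.
revert c d; induction l as [|x l IH]; intros c d; simpl.
  now rewrite plus_zero_l.
rewrite IH, scal_distr_r, <- !plus_assoc; f_equal.
rewrite !plus_assoc; f_equal; apply plus_comm.
Qed.

Lemma mlin_scal {K : Ring} {V : ModuleSpace K} (l : list V) (k : K) (c : nat -> K) :
  mlin (fun n => mult k (c n)) l = scal k (mlin c l).
Proof.
revert c; induction l as [|x l IH]; intros c; simpl.
  now rewrite scal_zero_r.
now rewrite IH, scal_distr_l, scal_assoc.
Qed.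

Lemma mlin_var {K : Ring} {V : ModuleSpace K} (l : list V) (m : nat) :
  mlin (fun n => if Nat.eqb m n then one else zero : K) l = nth m l zero.
Proof.
revert m; induction l as [|x l IH]; intros m; simpl; [now destruct m|].
destruct m; simpl.
  now rewrite scal_one, mlin_zero, plus_zero_r.
now rewrite IH, scal_zero_l, plus_zero_l.
Qed.

Lemma mlin_opp {K : Ring} {V : ModuleSpace K} (l : list V) (c : nat -> K) :
  mlin (fun n => opp (c n)) l = opp (mlin c l).
Proof.
revert c; induction l as [|x l IH]; intros c; simpl.
  symmetry; apply (@opp_zero V).
rewrite IH, scal_opp_l; symmetry; apply (@opp_plus V).
Qed.

Lemma meval_mlin {K : Ring} {V : ModuleSpace K} (l : list V) (e : mexpr K) :
  meval l e = mlin (mcoef e) l.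
Proof.
induction e as [n| |a IHa b IHb|a IH|k a IH]; simpl.
- symmetry; apply mlin_var.
- symmetry; apply mlin_zero.
- now rewrite mlin_plus, IHa, IHb.
- now rewrite mlin_opp, IH.
- now rewrite mlin_scal, IH.
Qed.

Lemma meval_eq {K : Ring} {V : ModuleSpace K} (l : list V) (e f : mexpr K) :
  meq (mcoef e) (mcoef f) l -> meval l e = meval l f.
Proof. intros H; rewrite !meval_mlin; now apply mlin_ext. Qed.

Ltac mod_index x l :=
  lazymatch l with
  | cons x _ => constr:(O)
  | cons _ ?l' => let n := mod_index x l' in constr:(S n)
  end.

Ltac mod_mem x l :=
  lazymatch l with
  | nil => constr:(false)
  | cons x _ => constr:(true)
  | cons _ ?l' => mod_mem x l'
  end.

Ltac mod_vars t l :=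
  lazymatch t with
  | plus ?a ?b => let l := mod_vars a l in mod_vars b l
  | minus ?a ?b => let l := mod_vars a l in mod_vars b l
  | opp ?a => mod_vars a l
  | scal _ ?a => mod_vars a l
  | zero => l
  | _ => lazymatch mod_mem t l with
         | true => l
         | false => constr:(cons t l)
         end
  end.

Ltac mod_reify K t l :=
  lazymatch t with
  | plus ?a ?b =>
      let a := mod_reify K a l in let b := mod_reify K b l in
      constr:(@MPlus K a b)
  | minus ?a ?b =>
      let a := mod_reify K a l in let b := mod_reify K b l in
      constr:(@MPlus K a (@MOpp K b))
  | opp ?a => let a := mod_reify K a l in constr:(@MOpp K a)
  | scal ?k ?a => let a := mod_reify K a l in constr:(@MScal K k a)
  | zero => constr:(@MZero K)
  | _ => let n := mod_index t l in constr:(@MVar K n)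
  end.

Ltac module_eq_in V K :=
  lazymatch goal with
  | |- ?a = ?b =>
      let l := mod_vars a (@nil V) in
      let l := mod_vars b l in
      let e := mod_reify K a l in
      let f := mod_reify K b l in
      apply (@meval_eq _ _ l e f);
      cbn -[Rplus Ropp Rmult Rinv Rdiv Rminus]; repeat split
  end.

(** The [change] steps expose the concrete operations of the reals to [ring] and [lra]; coefficient
    goals with division are left to the caller. *)
Ltac module_eq V :=
  module_eq_in V (AbsRing.sort R_AbsRing);
  repeat match goal with |- context [@plus ?G ?x ?y] => change (@plus G x y) with (Rplus x y)
   | |- context [@mult ?G ?x ?y] => change (@mult G x y) with (Rmult x y)
   | |- context [@opp ?G ?x] => change (@opp G x) with (Ropp x)
   | |- context [@one ?G] => change (@one G) with R1
   | |- context [@zero ?G] => change (@zero G) with R0 end;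
  try (ring || lra).

Ltac cmodule_eq E :=
  module_eq_in E (AbsRing.sort C_AbsRing);
  repeat match goal with |- context [@plus ?G ?x ?y] => change (@plus G x y) with (Cplus x y)
   | |- context [@mult ?G ?x ?y] => change (@mult G x y) with (Cmult x y)
   | |- context [@opp ?G ?x] => change (@opp G x) with (Copp x)
   | |- context [@one ?G] => change (@one G) with (RtoC 1)
   | |- context [@zero ?G] => change (@zero G) with (RtoC 0) end;
  try ring.

(** * Limits in normed modules *)

Lemma at_right_0_iff (P : R -> Prop) :
  at_right 0 P <-> exists d, 0 < d /\ forall t, 0 < t < d -> P t.
Proof.
split.
- intros [d Hd]; exists d; split; [apply cond_pos|].
  intros t Ht; apply Hd; [|apply Ht].
  change (Rabs (t - 0) < d); rewrite Rminus_0_r, Rabs_pos_eq; lra.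
- intros (d & Hd & H); exists (mkposreal d Hd); intros t Ht Ht0; apply H.
  change (Rabs (t - 0) < d) in Ht; rewrite Rminus_0_r, Rabs_pos_eq in Ht; lra.
Qed.

Section Limits.
Context {V : CompleteNormedModule R_AbsRing} {T : Type} {F : (T -> Prop) -> Prop}
  {FF : ProperFilter F}.

Lemma filterlim_norm_iff (f : T -> V) (l : V) :
  filterlim f F (locally l) <->
  forall e, 0 < e -> F (fun x => norm (minus (f x) l) < e).
Proof.
rewrite (filterlim_locally_ball_norm f l); split.
- intros H e He; exact (H (mkposreal e He)).
- intros H e; exact (H e (cond_pos e)).
Qed.

Lemma lim_plus (f g : T -> V) (a b : V) :
  filterlim f F (locally a) -> filterlim g F (locally b) ->
  filterlim (fun x => plus (f x) (g x)) F (locally (plus a b)).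
Proof.
intros Hf Hg; eapply filterlim_comp_2; [exact Hf|exact Hg|exact (filterlim_plus a b)].
Qed.

Lemma lim_opp (f : T -> V) (a : V) :
  filterlim f F (locally a) -> filterlim (fun x => opp (f x)) F (locally (opp a)).
Proof. intros Hf; exact (filterlim_comp _ _ _ _ _ _ _ _ Hf (filterlim_opp a)). Qed.

Lemma lim_minus (f g : T -> V) (a b : V) :
  filterlim f F (locally a) -> filterlim g F (locally b) ->
  filterlim (fun x => minus (f x) (g x)) F (locally (minus a b)).
Proof. intros Hf Hg; apply lim_plus; [easy|now apply lim_opp]. Qed.

Lemma lim_scal (c : T -> R) (f : T -> V) (k : R) (a : V) :
  filterlim c F (locally (k : R_AbsRing)) -> filterlim f F (locally a) ->
  filterlim (fun x => scal (c x) (f x)) F (locally (scal k a)).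
Proof.
intros Hc Hf; eapply filterlim_comp_2; [exact Hc|exact Hf|exact (filterlim_scal k a)].
Qed.

Lemma lim_scal_r (k : R) (f : T -> V) (a : V) :
  filterlim f F (locally a) ->
  filterlim (fun x => scal k (f x)) F (locally (scal k a)).
Proof. intros Hf; apply lim_scal; [apply filterlim_const|easy]. Qed.

Lemma lim_linear {W : CompleteNormedModule R_AbsRing} (L : V -> W) (f : T -> V) (a : V) :
  is_linear L -> filterlim f F (locally a) ->
  filterlim (fun x => L (f x)) F (locally (L a)).
Proof.
intros HL Hf; exact (filterlim_comp _ _ _ _ _ _ _ _ Hf (linear_cont L a HL)).
Qed.

Lemma lim_norm_le (f : T -> V) (l : V) (c : R) :
  filterlim f F (locally l) -> F (fun x => norm (f x) <= c) -> norm l <= c.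
Proof.
intros Hf Hc.
assert (H := filterlim_comp _ _ _ _ _ _ _ _ Hf (filterlim_norm l)).
exact (filterlim_le (fun x => norm (f x)) (fun _ => c) (norm l) c Hc H
  (filterlim_const _)).
Qed.

Lemma lim_unique (f : T -> V) (a b : V) :
  filterlim f F (locally a) -> filterlim f F (locally b) -> a = b.
Proof. apply (filterlim_locally_unique (V := V)). Qed.

End Limits.

Lemma norm_minus_sym {V : CompleteNormedModule R_AbsRing} (x y : V) :
  norm (minus x y) = norm (minus y x).
Proof. rewrite <- norm_opp; f_equal; module_eq V. Qed.

Lemma lim_cauchy {V : CompleteNormedModule R_AbsRing} {T : Type}
    {F : (T -> Prop) -> Prop} {FF : ProperFilter F} (f : T -> V) :
  (forall e, 0 < e -> exists P, F P /\
     forall u v, P u -> P v -> norm (minus (f u) (f v)) < e) ->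
  exists l, filterlim f F (locally l).
Proof.
intros H; apply (filterlim_locally_cauchy (U := V) (F := F)).
intros e; destruct (H e (cond_pos e)) as (P & HP & HPe).
exists P; split; [easy|]; intros u v Hu Hv.
apply (norm_compat1 (V := V)), HPe; easy.
Qed.

(** The structure only provides the upper bound; the lower one is that bound applied to [/ k] and
    [scal k x]. *)
Lemma norm_scal_R {V : CompleteNormedModule R_AbsRing} (k : R) (x : V) :
  norm (scal k x) = Rabs k * norm x.
Proof.
apply Rle_antisym; [exact (norm_scal k x)|].
destruct (Req_dec k 0) as [->|Hk].
  rewrite Rabs_R0, Rmult_0_l; apply norm_ge_0.
assert (Hp := Rabs_pos_lt k Hk).
assert (H := norm_scal (/ k : R) (scal k x)).
rewrite scal_assoc in H.
change (mult (/ k) k) with (/ k * k) in H.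
rewrite Rinv_l in H by easy.
change (norm (scal (one : R_AbsRing) x) <= Rabs (/ k) * norm (scal k x)) in H.
rewrite scal_one, Rabs_inv in H.
apply Rmult_le_reg_l with (/ Rabs k); [now apply Rinv_0_lt_compat|].
rewrite <- Rmult_assoc, Rinv_l, Rmult_1_l by lra; exact H.
Qed.

Lemma norm_minus_self {V : CompleteNormedModule R_AbsRing} (x : V) :
  norm (minus x x) = 0.
Proof. replace (minus x x) with (zero : V) by module_eq V; exact norm_zero. Qed.

Lemma norm_minus_le {V : CompleteNormedModule R_AbsRing} (x y : V) :
  norm (minus x y) <= norm x + norm y.
Proof. 
rewrite <- (norm_opp y); exact (norm_triangle x (opp y)). Qed.

Lemma norm_minus_triangle {V : CompleteNormedModule R_AbsRing} (x y z : V) :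
  norm (minus x y) <= norm (minus x z) + norm (minus y z).
Proof.
replace (minus x y) with (minus (minus x z : V) (minus y z)) by module_eq V.
apply norm_minus_le.
Qed.

(** * Uniform boundedness *)

Section UniformBoundedness.
Context {V W : CompleteNormedModule R_AbsRing} {I : Type} (L : I -> V -> W).
Hypothesis HL : forall i, is_linear (L i).

(** A small multiple [k x] of any vector is a difference of two points of the ball, [x0 + k x] and
    [x0], so [k * norm (L i x) <= 2 * C]. With [k = r / (2 norm x)] this gives the factor [4 C / r];
    the absolute value and the [+ 1] only make the constant positive. *)
Lemma bounded_on_ball_bounded (x0 : V) (r C : R) :
  0 < r -> (forall i x, norm (minus x x0) < r -> norm (L i x) <= C) ->
  exists M, 0 < M /\ forall i x, norm (L i x) <= M * norm x.
Proof.
intros Hr HC; exists (4 * Rabs C / r + 1).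
assert (HA := Rabs_pos C).
assert (Hq : 0 <= 4 * Rabs C / r) by (apply Rdiv_le_0_compat; lra).
split; [lra|]; intros i x.
destruct (Req_dec (norm x) 0) as [Hx|Hx].
  rewrite (norm_eq_zero x Hx), linear_zero, !norm_zero by apply HL; lra.
assert (Hx0 : 0 < norm x) by (assert (H := norm_ge_0 x); lra).
set (k := r / 2 / norm x).
assert (Hk : 0 < k) by (apply Rdiv_lt_0_compat; lra).
assert (H1 : norm (L i (plus x0 (scal k x))) <= C).
  apply HC.
  replace (minus (plus x0 (scal k x)) x0) with (scal k x) by module_eq V.
  rewrite norm_scal_R, Rabs_pos_eq by lra; unfold k; field_simplify; lra.
assert (H2 : norm (L i x0) <= C).
  apply HC; rewrite norm_minus_self; easy.
assert (H3 : scal k (L i x) = minus (L i (plus x0 (scal k x))) (L i x0)).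
  rewrite (linear_plus _ (HL i)), (linear_scal _ (HL i)); module_eq W.
assert (H4 : k * norm (L i x) <= 2 * C).
  replace (k * norm (L i x)) with (norm (scal k (L i x))).
    rewrite H3; eapply Rle_trans; [apply norm_minus_le|lra].
  now rewrite norm_scal_R, Rabs_pos_eq by lra.
assert (HC' := Rle_abs C).
apply Rmult_le_reg_l with k; [easy|].
apply Rle_trans with (2 * C); [easy|].
replace (k * ((4 * Rabs C / r + 1) * norm x)) with (2 * Rabs C + r / 2)
  by (unfold k; field; lra).
lra.
Qed.

Hypothesis Hpt : forall x, exists C, forall i, norm (L i x) <= C.

(** Without a uniform bound the family is unbounded on every ball. This yields nested balls with
    radii tending to 0, on the successive ones of which some [L i] exceeds 0, 1, 2, ... The limit of
    the centres lies in all of them and contradicts the pointwise bound. *)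
Lemma uniform_boundedness :
  exists M, 0 < M /\ forall i x, norm (L i x) <= M * norm x.
Proof.
apply NNPP; intros Hno.
assert (Hball : forall (x0 : V) (r C : R), 0 < r ->
    exists i x, norm (minus x x0) < r /\ C < norm (L i x)).
  intros x0 r C Hr; apply NNPP; intros H; apply Hno.
  apply (bounded_on_ball_bounded x0 r C Hr); intros i x Hx.
  destruct (Rle_lt_dec (norm (L i x)) C) as [Hle|Hlt]; [easy|].
  exfalso; apply H; now exists i, x.
(* A pair is a centre with a radius; the first condition places the closed ball [q] inside the
   closed ball [p]. *)
set (step := fun (k : nat) (p q : V * {r : R | 0 < r}) =>
  norm (minus (fst q) (fst p)) + proj1_sig (snd q) <= proj1_sig (snd p) /\
  proj1_sig (snd q) <= / (INR k + 1) /\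
  exists i, forall y, norm (minus y (fst q)) <= proj1_sig (snd q) ->
    INR k < norm (L i y)).
assert (Hstep : forall k p, exists q, step k p q).
  intros k [x0 [r Hr]]; destruct (Hball x0 r (INR k) Hr) as (i & x & Hx & HLx).
  destruct (linear_norm _ (HL i)) as (M & HM & HMx).
  assert (Hk : 0 < / (INR k + 1)) by (apply Rinv_0_lt_compat; assert (H := pos_INR k); lra).
  (* Within distance [d] of [x], the norm of [L i] drops by at most half of its excess over
     [INR k]. *)
  set (d := (norm (L i x) - INR k) / (2 * M)).
  assert (Hd : 0 < d) by (apply Rdiv_lt_0_compat; lra).
  set (r' := Rmin (r - norm (minus x x0)) (Rmin (/ (INR k + 1)) d)).
  assert (Hr' : 0 < r') by (repeat apply Rmin_pos; lra).
  assert (Hr1 : r' <= r - norm (minus x x0)) by apply Rmin_l.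
  assert (Hr2 : r' <= / (INR k + 1)) by (eapply Rle_trans; [apply Rmin_r|apply Rmin_l]).
  assert (Hr3 : r' <= d) by (eapply Rle_trans; [apply Rmin_r|apply Rmin_r]).
  exists (x, exist _ r' Hr'); unfold step; simpl; split; [lra|split; [easy|]].
  exists i; intros y Hy.
  assert (H1 : norm (L i (minus y x)) <= M * d).
    eapply Rle_trans; [apply HMx|apply Rmult_le_compat_l; lra].
  replace (M * d) with ((norm (L i x) - INR k) / 2) in H1 by (unfold d; field; lra).
  assert (H2 : norm (L i x) <= norm (L i y) + norm (L i (minus y x))).
    replace (L i x) with (minus (L i y) (L i (minus y x))).
      apply norm_minus_le.
    rewrite (linear_minus _ _ _ (HL i)); module_eq W.
  lra.
set (F := fun k p => proj1_sig (constructive_indefinite_description _ (Hstep k p))).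
assert (HF : forall k p, step k p (F k p)).
  intros k p; unfold F; exact (proj2_sig (constructive_indefinite_description _ (Hstep k p))).
set (p := fix p n := match n with
  | O => (zero, exist _ 1 Rlt_0_1) : V * {r : R | 0 < r}
  | S n => F n (p n) end).
assert (Hp : forall n, step n (p n) (p (S n))) by (intros n; apply HF).
clearbody p.
assert (Hnest : forall n m, norm (minus (fst (p (n + m)%nat)) (fst (p n))) +
    proj1_sig (snd (p (n + m)%nat)) <= proj1_sig (snd (p n))).
  intros n m; induction m as [|m IH].
    rewrite Nat.add_0_r; rewrite norm_minus_self; lra.
  rewrite Nat.add_succ_r; destruct (Hp (n + m)%nat) as (H & _ & _).
  assert (H2 : norm (minus (fst (p (S (n + m)))) (fst (p n))) <=
    norm (minus (fst (p (S (n + m)))) (fst (p (n + m)%nat))) +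
    norm (minus (fst (p (n + m)%nat)) (fst (p n)))).
    eapply Rle_trans; [|apply norm_triangle]; right; f_equal; module_eq V.
  lra.
assert (Hdist : forall n m, (n <= m)%nat ->
    norm (minus (fst (p m)) (fst (p n))) <= proj1_sig (snd (p n))).
  intros n m Hnm; assert (H := Hnest n (m - n)%nat).
  replace (n + (m - n))%nat with m in H by lia.
  assert (H2 := proj2_sig (snd (p m))); simpl in H2; lra.
destruct (lim_cauchy (F := eventually) (fun n => fst (p n))) as [x Hx].
  intros e He.
    destruct (nfloor_ex (2 / e)) as [N HN]; [left; apply Rdiv_lt_0_compat; lra|].
  exists (fun n => (S N <= n)%nat); split; [now exists (S N)|].
  assert (Hr : proj1_sig (snd (p (S N))) < e / 2).
    destruct (Hp N) as (_ & H & _); eapply Rle_lt_trans; [exact H|].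
    replace (e / 2) with (/ (2 / e)) by (field; lra).
    apply Rinv_lt_contravar; [|lra].
    apply Rmult_lt_0_compat; [apply Rdiv_lt_0_compat; lra|assert (H' := pos_INR N); lra].
  intros u v Hu Hv.
  assert (H1 := Hdist _ _ Hu); assert (H2 := Hdist _ _ Hv).
  eapply Rle_lt_trans; [apply (norm_minus_triangle _ _ (fst (p (S N))))|lra].
destruct (Hpt x) as [C HC].
destruct (nfloor_ex (Rabs C)) as [N HN]; [apply Rabs_pos|].
assert (Hlt : C < INR (S N)) by (rewrite S_INR; assert (H := Rle_abs C); lra).
(* The lower bound [INR (S N)], which exceeds [C], holds on the ball with index [S (S N)]. *)
destruct (Hp (S N)) as (_ & _ & i & Hi).
assert (Hx' : norm (minus (fst (p (S (S N)))) x) <= proj1_sig (snd (p (S (S N))))).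
  apply (lim_norm_le (F := eventually) (fun m => minus (fst (p (S (S N)))) (fst (p m))) _ _
    (lim_minus (fun _ => fst (p (S (S N)))) _ _ _ (filterlim_const _) Hx)).
  exists (S (S N)); intros m Hm; rewrite norm_minus_sym; now apply Hdist.
rewrite norm_minus_sym in Hx'; specialize (Hi x Hx'); specialize (HC i); lra.
Qed.

End UniformBoundedness.

(** * Real C0-semigroups *)

(** The real counterpart of [is_C0_semigroup]; the complex semigroups reach it through [realify]. *)
Record real_semigroup {V : CompleteNormedModule R_AbsRing}
    (U : R -> V -> V) : Prop := {
  rs_linear : forall t, 0 <= t -> is_linear (U t);
  rs_zero : forall f, U 0 f = f;
  rs_plus : forall s t f, 0 <= s -> 0 <= t -> U (s + t) f = U s (U t f);
  rs_continuous : forall f, filterlim (fun t => U t f) (at_right 0) (locally f)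
}.

Definition real_generator {V : CompleteNormedModule R_AbsRing}
    (U : R -> V -> V) (f g : V) : Prop :=
  filterlim (fun t : R => scal (/ t) (minus (U t f) f)) (at_right 0) (locally g).

(* Clamping at [0] makes the orbit continuous on the whole line. *)
Definition orbit {V : CompleteNormedModule R_AbsRing} (U : R -> V -> V) (f : V)
    (t : R) : V := U (Rmax 0 t) f.

Definition orbit_int {V : CompleteNormedModule R_AbsRing} (U : R -> V -> V)
    (tau : R) (f : V) : V := RInt (orbit U f) 0 tau.

Lemma is_RInt_linear {V W : CompleteNormedModule R_AbsRing} (L : V -> W)
    (f : R -> V) (a b : R) (l : V) :
  is_linear L -> is_RInt f a b l -> is_RInt (fun t => L (f t)) a b (L l).
Proof.
intros HL Hf; unfold is_RInt.
apply filterlim_ext with (fun ptd => L (scal (sign (b - a)) (Riemann_sum f ptd))).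
  intros ptd; rewrite (linear_scal _ HL); f_equal.
  unfold Riemann_sum.
  (* The left endpoint of the first interval changes along the recursion, so the induction must hold
     for every starting pair. *)
  set (p := (SF_h ptd, _)); clearbody p; revert p.
  induction (SF_t ptd) as [|x s IH]; simpl; intros p; [exact (linear_zero L HL)|].
  eapply eq_trans; [exact (linear_plus _ HL _ _)|]; f_equal; [|apply IH].
  exact (linear_scal _ HL _ _).
now apply lim_linear.
Qed.

Section RealSemigroup.
Context {V : CompleteNormedModule R_AbsRing} (U : R -> V -> V).
Hypothesis HU : real_semigroup U.

(** Otherwise there are times [t n] tending to 0 for which [U (t n)] has norm above [n + 1]. But
    [U (t n) f] tends to [f], so these operators are pointwise bounded, against uniform
    boundedness. *)
Lemma real_semigroup_local_bound :
  exists d M, 0 < d /\ 1 <= M /\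
    forall t f, 0 <= t <= d -> norm (U t f) <= M * norm f.
Proof.
apply NNPP; intros Hno.
assert (H : forall n : nat, exists t, 0 <= t <= / (INR n + 1) /\
    exists f, (INR n + 1) * norm f < norm (U t f)).
  intros n; apply NNPP; intros H; apply Hno.
  assert (Hn := pos_INR n).
  exists (/ (INR n + 1)), (INR n + 1); split; [apply Rinv_0_lt_compat; lra|split; [lra|]].
  intros t f Ht; apply Rnot_lt_le; intros Hlt; apply H; exists t; split; [easy|now exists f].
set (t := fun n => proj1_sig (constructive_indefinite_description _ (H n))).
assert (Ht : forall n, 0 <= t n <= / (INR n + 1) /\
    exists f, (INR n + 1) * norm f < norm (U (t n) f)).
  intros n; exact (proj2_sig (constructive_indefinite_description _ (H n))).
clearbody t.
destruct (uniform_boundedness (fun n => U (t n))) as (M & HM & HMx).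
- intros n; apply (rs_linear _ HU), Ht.
- intros f.
  destruct (filterlim_bounded (V := V) (fun n => U (t n) f)) as [C HC].
    exists f; apply (filterlim_norm_iff (F := eventually)); intros e He.
    destruct (proj1 (at_right_0_iff _)
      (proj1 (filterlim_norm_iff _ _) (rs_continuous _ HU f) e He)) as (d & Hd & Hde).
    destruct (nfloor_ex (/ d)) as [N HN]; [left; now apply Rinv_0_lt_compat|].
    exists N; intros n Hn; destruct (Ht n) as [[H0 H1] _].
    destruct (Req_dec (t n) 0) as [->|Hne].
      now rewrite (rs_zero _ HU), norm_minus_self.
    apply Hde; split; [lra|]; eapply Rle_lt_trans; [exact H1|].
    apply le_INR in Hn; rewrite <- (Rinv_inv d); apply Rinv_lt_contravar; [|lra].
    apply Rmult_lt_0_compat; [now apply Rinv_0_lt_compat|assert (H2 := pos_INR n); lra].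
  now exists C.
- destruct (nfloor_ex M) as [N HN]; [lra|].
  destruct (Ht N) as (_ & f & Hf); specialize (HMx N f).
  assert (H0 := norm_ge_0 f).
  assert (M * norm f <= (INR N + 1) * norm f) by (apply Rmult_le_compat_r; lra).
  lra.
Qed.

Lemma real_semigroup_growth :
  exists M w, 1 <= M /\ 0 <= w /\
    forall t f, 0 <= t -> norm (U t f) <= M * exp (w * t) * norm f.
Proof.
destruct real_semigroup_local_bound as (d & M & Hd & HM & Hb).
(* Chosen so that [exp (w * d) = M]: each step of length [d] costs a factor [M], which the
   exponential absorbs. The induction below counts these steps. *)
set (w := ln M / d).
assert (Hw : 0 <= w).
  apply Rdiv_le_0_compat; [|easy]; rewrite <- ln_1; now apply ln_le; [lra|].
exists M, w; split; [easy|split; [easy|]].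
assert (Hn : forall n t f, 0 <= t -> t < INR n * d ->
    norm (U t f) <= M * exp (w * t) * norm f).
  induction n as [|n IH]; intros t f Ht Htn; [simpl in Htn; lra|].
  rewrite S_INR in Htn; destruct (Rle_lt_dec t d) as [Htd|Htd].
    eapply Rle_trans; [apply Hb; lra|].
    apply Rmult_le_compat_r; [apply norm_ge_0|].
    assert (H : 1 <= exp (w * t)).
      rewrite <- exp_0; destruct (Rmult_le_pos w t Hw Ht) as [H|H].
        now left; apply exp_increasing.
      rewrite <- H; lra.
    rewrite <- (Rmult_1_r M) at 1; apply Rmult_le_compat_l; lra.
  replace t with (d + (t - d)) at 1 by ring.
  rewrite (rs_plus _ HU) by lra.
  eapply Rle_trans; [apply Hb; lra|].
  replace (M * exp (w * t) * norm f)
    with (M * (M * exp (w * (t - d)) * norm f)).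
    apply Rmult_le_compat_l; [lra|apply IH; lra].
  replace (w * (t - d)) with (w * t + - ln M) by (unfold w; field; lra).
  rewrite exp_plus, exp_Ropp, exp_ln by lra; field; lra.
intros t f Ht.
destruct (nfloor_ex (t / d)) as [N HN]; [now apply Rdiv_le_0_compat|].
apply (Hn (S N)); [easy|]; rewrite S_INR.
replace t with (t / d * d) by (field; lra); apply Rmult_lt_compat_r; lra.
Qed.

Lemma real_semigroup_bounded_on (b : R) : 0 <= b ->
  exists C, 0 < C /\ forall t f, 0 <= t <= b -> norm (U t f) <= C * norm f.
Proof.
destruct real_semigroup_growth as (M & w & HM & Hw & H); intros Hb.
assert (He := exp_pos (w * b)).
exists (M * exp (w * b)); split; [apply Rmult_lt_0_compat; lra|]; intros t f Ht.
eapply Rle_trans; [apply H; lra|].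
apply Rmult_le_compat_r; [apply norm_ge_0|apply Rmult_le_compat_l; [lra|]].
assert (Hwt : w * t <= w * b) by (apply Rmult_le_compat_l; lra).
destruct Hwt as [Hwt | ->]; [left; now apply exp_increasing|lra].
Qed.

(** For [x < y] the increment is [U x (U (y - x) f - f)]. With [U] bounded on compact intervals,
    right continuity at 0 therefore gives continuity from both sides. *)
Lemma orbit_continuous (f : V) (t : R) : continuous (orbit U f) t.
Proof.
apply (filterlim_norm_iff (F := locally t)); intros e He.
set (a := Rmax 0 t); assert (Ha : 0 <= a) by apply Rmax_l.
destruct (real_semigroup_bounded_on (a + 1)) as (C & HC & HCx); [lra|].
assert (HeC : 0 < e / C) by now apply Rdiv_lt_0_compat.
destruct (proj1 (at_right_0_iff _)
  (proj1 (filterlim_norm_iff _ _) (rs_continuous _ HU f) (e / C) HeC)) as (d & Hd & Hde).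
assert (Hd1 : 0 < Rmin d 1) by (apply Rmin_pos; lra).
assert (Hm1 : Rmin d 1 <= d) by apply Rmin_l.
assert (Hm2 : Rmin d 1 <= 1) by apply Rmin_r.
assert (Hinc : forall x y, 0 <= x -> x < y -> y - x < d -> x <= a + 1 ->
    norm (minus (U y f) (U x f)) < e).
  intros x y Hx Hxy Hd' Hxa.
  replace y with (x + (y - x)) by ring.
  rewrite (rs_plus _ HU), <- (linear_minus _ _ _ (rs_linear _ HU x Hx)) by lra.
  eapply Rle_lt_trans; [apply HCx; lra|].
  replace e with (C * (e / C)) by (field; lra).
  apply Rmult_lt_compat_l, Hde; lra.
exists (mkposreal _ Hd1); intros s Hs; change (Rabs (s - t) < Rmin d 1) in Hs.
unfold orbit; fold a; set (b := Rmax 0 s).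
assert (Hb : 0 <= b) by apply Rmax_l.
assert (Hab : Rabs (b - a) < Rmin d 1).
  unfold a, b, Rmax; repeat destruct Rle_dec; revert Hs; unfold Rabs;
  repeat destruct Rcase_abs; lra.
apply Rabs_def2 in Hab.
destruct (Rtotal_order a b) as [H|[H|H]].
- apply Hinc; lra.
- now rewrite H, norm_minus_self.
- rewrite norm_minus_sym; apply Hinc; lra.
Qed.

Lemma orbit_ex_RInt (f : V) (a b : R) : ex_RInt (orbit U f) a b.
Proof. apply ex_RInt_continuous; intros; apply orbit_continuous. Qed.

Lemma orbit_int_correct (f : V) (tau : R) :
  is_RInt (orbit U f) 0 tau (orbit_int U tau f).
Proof. apply RInt_correct, orbit_ex_RInt. Qed.

Lemma orbit_shift (f : V) (h t : R) : 0 <= h -> 0 <= t ->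
  orbit U f (t + h) = U h (orbit U f t).
Proof.
intros Hh Ht; unfold orbit; rewrite !Rmax_right by lra.
rewrite Rplus_comm; now apply (rs_plus _ HU).
Qed.

Lemma orbit_int_shift (f : V) (h tau : R) : 0 <= h -> 0 <= tau ->
  U h (orbit_int U tau f) = minus (orbit_int U (tau + h) f) (orbit_int U h f).
Proof.
intros Hh Htau.
assert (H1 := is_RInt_linear _ _ _ _ _ (rs_linear _ HU h Hh) (orbit_int_correct f tau)).
assert (H2 : is_RInt (fun t => U h (orbit U f t)) 0 tau (RInt (orbit U f) h (tau + h))).
  apply is_RInt_ext with (fun t => scal 1 (orbit U f (1 * t + h))).
    intros t Ht; rewrite Rmin_left in Ht by easy.
    rewrite Rmult_1_l, orbit_shift by lra; module_eq V.
  apply (is_RInt_comp_lin (V := V) (orbit U f) 1 h 0 tau).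
  replace (1 * 0 + h) with h by ring; replace (1 * tau + h) with (tau + h) by ring.
  apply RInt_correct, orbit_ex_RInt.
rewrite <- (is_RInt_unique _ _ _ _ H1), (is_RInt_unique _ _ _ _ H2).
unfold orbit_int.
rewrite <- (RInt_Chasles (orbit U f) 0 h (tau + h)) by apply orbit_ex_RInt.
module_eq V.
Qed.

Lemma orbit_int_commutes (f : V) (h tau : R) : 0 <= h -> 0 <= tau ->
  orbit_int U tau (U h f) = U h (orbit_int U tau f).
Proof.
intros Hh Htau; apply is_RInt_unique.
apply is_RInt_ext with (fun t => U h (orbit U f t)).
  intros t Ht; rewrite Rmin_left in Ht by easy.
  rewrite <- orbit_shift by lra; unfold orbit; rewrite !Rmax_right by lra.
  apply (rs_plus _ HU); lra.
exact (is_RInt_linear _ _ _ _ _ (rs_linear _ HU h Hh) (orbit_int_correct f tau)).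
Qed.

Lemma orbit_int_linear (tau : R) : 0 <= tau -> is_linear (orbit_int U tau).
Proof.
intros Htau; constructor.
- intros x y; apply is_RInt_unique.
  apply is_RInt_ext with (fun t => plus (orbit U x t) (orbit U y t)).
    intros t _; symmetry; apply (linear_plus _ (rs_linear _ HU _ (Rmax_l 0 t))).
  apply (is_RInt_plus (V := V)); apply orbit_int_correct.
- intros k x; apply is_RInt_unique.
  apply is_RInt_ext with (fun t => scal k (orbit U x t)).
    intros t _; symmetry; apply (linear_scal _ (rs_linear _ HU _ (Rmax_l 0 t))).
  apply (is_RInt_scal (V := V)); apply orbit_int_correct.
- destruct (real_semigroup_bounded_on tau Htau) as (C & HC & HCx).
  exists ((tau + 1) * C); split; [apply Rmult_lt_0_compat; lra|]; intros x.
  apply Rle_trans with (tau * (C * norm x)).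
    apply (norm_RInt_le (V := V) (orbit U x) (fun _ => C * norm x) 0 tau); [easy| |
      apply orbit_int_correct|].
      intros t Ht; unfold orbit; rewrite Rmax_right by lra; now apply HCx.
    assert (H := is_RInt_const (V := R_NormedModule) 0 tau (C * norm x)).
    rewrite Rminus_0_r in H; exact H.
  assert (H0 := norm_ge_0 x).
  assert (0 <= C * norm x) by (apply Rmult_le_pos; lra).
  lra.
Qed.

Lemma orbit_int_derive_0 (f : V) :
  filterlim (fun h => scal (/ h) (orbit_int U h f)) (at_right 0) (locally f).
Proof.
apply filterlim_norm_iff; intros e He.
apply at_right_0_iff.
destruct (proj1 (at_right_0_iff _)
  (proj1 (filterlim_norm_iff _ _) (rs_continuous _ HU f) (e / 2) ltac:(lra))) as (d & Hd & Hde).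
exists d; split; [easy|]; intros h Hh.
assert (H : norm (minus (orbit_int U h f) (scal h f)) <= h * (e / 2)).
  apply (norm_RInt_le (V := V) (fun t => minus (orbit U f t) f) (fun _ => e / 2) 0 h); [lra| | |].
  - intros t Ht; unfold orbit; rewrite Rmax_right by lra.
    destruct (Req_dec t 0) as [->|Hne].
      rewrite (rs_zero _ HU), norm_minus_self; lra.
    left; apply Hde; lra.
  - apply (is_RInt_minus (V := V)); [apply orbit_int_correct|].
    assert (H := is_RInt_const (V := V) 0 h f).
    rewrite Rminus_0_r in H; exact H.
  - assert (H := is_RInt_const (V := R_NormedModule) 0 h (e / 2)).
    rewrite Rminus_0_r in H; exact H.
assert (Heq : minus (scal (/ h) (orbit_int U h f)) f =
  scal (/ h) (minus (orbit_int U h f) (scal h f))) by (module_eq V; field; lra).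
eapply Rle_lt_trans; [right; exact (f_equal norm Heq)|].
assert (Hi : 0 < / h) by now apply Rinv_0_lt_compat.
rewrite norm_scal_R, Rabs_pos_eq by lra.
apply Rle_lt_trans with (/ h * (h * (e / 2))); [apply Rmult_le_compat_l; lra|].
rewrite <- Rmult_assoc, Rinv_l; lra.
Qed.

(** By [orbit_int_shift], both [U h - 1] applied to the integral up to [tau] and [U tau - 1] applied
    to the integral up to [h] equal the integral up to [tau + h] minus the other two. So the
    difference quotient is [U tau - 1] applied to a mean value that tends to [f]. *)
Lemma orbit_int_generator (f : V) (tau : R) : 0 <= tau ->
  real_generator U (orbit_int U tau f) (minus (U tau f) f).
Proof.
intros Htau; unfold real_generator.
apply filterlim_ext_loc with
  (fun h => minus (U tau (scal (/ h) (orbit_int U h f))) (scal (/ h) (orbit_int U h f))).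
  apply at_right_0_iff; exists 1; split; [lra|]; intros h Hh.
  rewrite (linear_scal _ (rs_linear _ HU tau Htau)).
  rewrite !orbit_int_shift by lra; rewrite (Rplus_comm h tau); module_eq V.
apply lim_minus; [|apply orbit_int_derive_0].
apply (lim_linear (U tau)); [now apply (rs_linear _ HU)|apply orbit_int_derive_0].
Qed.

Lemma real_generator_unique (f g g' : V) :
  real_generator U f g -> real_generator U f g' -> g = g'.
Proof. apply (lim_unique (F := at_right 0)). Qed.

Lemma real_generator_commutes (L : V -> V) (f g : V) :
  is_linear L -> (forall t x, 0 <= t -> L (U t x) = U t (L x)) ->
  real_generator U f g -> real_generator U (L f) (L g).
Proof.
intros HL Hc H; unfold real_generator.
apply filterlim_ext_loc with (fun t => L (scal (/ t) (minus (U t f) f))).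
  apply at_right_0_iff; exists 1; split; [lra|]; intros h Hh.
  rewrite (linear_scal _ HL), (linear_minus _ _ _ HL), Hc by lra; reflexivity.
now apply (lim_linear L).
Qed.

(** The integral of [U] over the half line is the resolvent of the generator at 0, that is, minus
    its inverse. Other points of the resolvent set are reached by rescaling the semigroup. *)
Lemma laplace_inverse :
  (forall f, exists l, filterlim (fun tau => orbit_int U tau f) (Rbar_locally p_infty) (locally l)) ->
  exists S : V -> V, is_linear S /\
    (forall f, filterlim (fun tau => orbit_int U tau f) (Rbar_locally p_infty) (locally (S f))) /\
    (forall f, real_generator U (S f) (opp f)) /\
    (forall f g, real_generator U f g -> S g = opp f).
Proof.
intros Hconv.
set (S := fun f => proj1_sig (constructive_indefinite_description _ (Hconv f))).
assert (HS : forall f, filterlim (fun tau => orbit_int U tau f) (Rbar_locally p_infty) (locally (S f))).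
  intros f; exact (proj2_sig (constructive_indefinite_description _ (Hconv f))).
clearbody S.
assert (Hpos : Rbar_locally p_infty (fun tau => 0 <= tau)) by (exists 0; intros; lra).
assert (HINR : filterlim INR eventually (Rbar_locally p_infty)) by exact is_lim_seq_INR.
assert (HlS : is_linear S).
  constructor.
  - intros x y; apply (lim_unique (F := Rbar_locally p_infty) (fun tau => orbit_int U tau (plus x y))).
      apply HS.
    apply filterlim_ext_loc with (fun tau => plus (orbit_int U tau x) (orbit_int U tau y)).
      revert Hpos; apply filter_imp; intros tau Htau.
      now rewrite (linear_plus _ (orbit_int_linear tau Htau)).
    apply lim_plus; apply HS.
  - intros k x; apply (lim_unique (F := Rbar_locally p_infty) (fun tau => orbit_int U tau (scal k x))).
      apply HS.
    apply filterlim_ext_loc with (fun tau => scal k (orbit_int U tau x)).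
      revert Hpos; apply filter_imp; intros tau Htau.
      now rewrite (linear_scal _ (orbit_int_linear tau Htau)).
    apply lim_scal_r, HS.
  (* Integer times suffice to reach the limit, and a convergent sequence is bounded over all its
     indices. *)
  - destruct (uniform_boundedness (fun n => orbit_int U (INR n))) as (M & HM & HMx).
    + intros n; apply orbit_int_linear, pos_INR.
    + intros x; destruct (filterlim_bounded (V := V) (fun n => orbit_int U (INR n) x)) as [C HC].
        exists (S x); exact (filterlim_comp _ _ _ _ _ _ _ _ HINR (HS x)).
      now exists C.
    + exists M; split; [easy|]; intros x.
      apply (lim_norm_le (F := eventually) (fun n => orbit_int U (INR n) x)).
        exact (filterlim_comp _ _ _ _ _ _ _ _ HINR (HS x)).
      exists O; intros n _; apply HMx.
assert (Hshift : forall h f, 0 <= h -> U h (S f) = minus (S f) (orbit_int U h f)).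
  intros h f Hh.
  apply (lim_unique (F := Rbar_locally p_infty) (fun tau => U h (orbit_int U tau f))).
    apply (lim_linear (U h)); [now apply (rs_linear _ HU)|apply HS].
  apply filterlim_ext_loc with (fun tau => minus (orbit_int U (tau + h) f) (orbit_int U h f)).
    revert Hpos; apply filter_imp; intros tau Htau; now rewrite orbit_int_shift.
  apply lim_minus; [|apply filterlim_const].
  refine (filterlim_comp _ _ _ (fun tau => tau + h) (fun tau => orbit_int U tau f) _ _ _ _ (HS f)).
  intros P [M HM]; exists M; intros x Hx; apply HM; lra.
assert (Hcomm : forall h f, 0 <= h -> S (U h f) = U h (S f)).
  intros h f Hh.
  apply (lim_unique (F := Rbar_locally p_infty) (fun tau => orbit_int U tau (U h f))); [apply HS|].
  apply filterlim_ext_loc with (fun tau => U h (orbit_int U tau f)).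
    revert Hpos; apply filter_imp; intros tau Htau; now rewrite orbit_int_commutes.
  apply (lim_linear (U h)); [now apply (rs_linear _ HU)|apply HS].
assert (Hgen : forall f, real_generator U (S f) (opp f)).
  intros f; unfold real_generator.
  apply filterlim_ext_loc with (fun h => opp (scal (/ h) (orbit_int U h f))).
    apply at_right_0_iff; exists 1; split; [lra|]; intros h Hh.
    rewrite Hshift by lra; module_eq V.
  apply lim_opp, orbit_int_derive_0.
exists S; split; [easy|split; [easy|split; [easy|]]].
(* [S] is bounded and commutes with [U], so the generator sends [S f] to [S g]; it also sends it to
   [opp f]. *)
intros f g Hfg; apply (real_generator_unique (S f)); [|apply Hgen].
now apply real_generator_commutes.
Qed.

End RealSemigroup.

(** * Restriction of scalars *)

Section Realify.
Variable E : CompleteNormedModule C_AbsRing.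

Definition realify_scal (a : R) (x : E) : E := scal (RtoC a) x.

Lemma realify_scal_assoc (a b : R) (x : E) :
  realify_scal a (realify_scal b x) = realify_scal (mult a b) x.
Proof.
transitivity (scal (Cmult (RtoC a) (RtoC b)) x).
  exact (scal_assoc (RtoC a : C_AbsRing) (RtoC b) x).
unfold realify_scal; f_equal; symmetry; apply RtoC_mult.
Qed.

Lemma realify_scal_one (x : E) : realify_scal one x = x.
Proof. exact (scal_one x). Qed.

Lemma realify_scal_distr_l (a : R) (x y : E) :
  realify_scal a (plus x y) = plus (realify_scal a x) (realify_scal a y).
Proof. exact (scal_distr_l (RtoC a) x y). Qed.

Lemma realify_scal_distr_r (a b : R) (x : E) :
  realify_scal (plus a b) x = plus (realify_scal a x) (realify_scal b x).
Proof.
transitivity (scal (Cplus (RtoC a) (RtoC b)) x).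
  unfold realify_scal; f_equal; apply RtoC_plus.
exact (scal_distr_r (RtoC a : C_AbsRing) (RtoC b) x).
Qed.

Definition realify_AbelianGroup : AbelianGroup :=
  CompleteNormedModule.AbelianGroup C_AbsRing E.

Definition realify_ModuleSpace_class : ModuleSpace.class_of R_Ring E :=
  ModuleSpace.Class R_Ring E (AbelianGroup.class realify_AbelianGroup)
    (ModuleSpace.Mixin R_Ring realify_AbelianGroup realify_scal realify_scal_assoc
      realify_scal_one realify_scal_distr_l realify_scal_distr_r).

Definition realify_NormedModuleAux_class : NormedModuleAux.class_of R_AbsRing E :=
  NormedModuleAux.Class R_AbsRing E realify_ModuleSpace_class
    (UniformSpace.class (CompleteNormedModule.UniformSpace C_AbsRing E)).

Lemma realify_norm_scal (a : R) (x : E) : norm (realify_scal a x) <= abs a * norm x.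
Proof.
change (abs a) with (Rabs a); rewrite <- Cmod_R; exact (norm_scal (RtoC a) x).
Qed.

Definition realify_NormedModule_class : NormedModule.class_of R_AbsRing E :=
  NormedModule.Class R_AbsRing E realify_NormedModuleAux_class
    (NormedModule.Mixin R_AbsRing
      (NormedModuleAux.Pack R_AbsRing E realify_NormedModuleAux_class E)
      (norm : E -> R) (norm_factor (V := E))
      (norm_triangle (V := E)) realify_norm_scal (norm_compat1 (V := E))
      (norm_compat2 (V := E)) (norm_eq_zero (V := E))).

(** Carrier, addition, uniform structure and norm are those of [E], so statements about limits and
    norms in [E] and in [realify E] are convertible. *)
Definition realify : CompleteNormedModule R_AbsRing :=
  CompleteNormedModule.Pack R_AbsRing E
    (CompleteNormedModule.Class R_AbsRing E realify_NormedModule_class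
      (CompleteNormedModule.mixin C_AbsRing E (CompleteNormedModule.class C_AbsRing E))) E.

Lemma realify_linear (L : E -> E) :
  is_linear L -> @is_linear R_AbsRing realify realify L.
Proof.
intros HL; constructor.
- exact (linear_plus _ HL).
- intros a; exact (linear_scal _ HL (RtoC a)).
- exact (linear_norm _ HL).
Qed.

Lemma scal_C_linear (c : C) : @is_linear C_AbsRing E E (fun x => scal c x).
Proof. exact (is_linear_scal_r (V := E) (c : C_AbsRing) Cmult_comm). Qed.

Lemma lim_scal_C {T : Type} {F : (T -> Prop) -> Prop} {FF : Filter F}
    (c : T -> C) (f : T -> E) (k : C) (l : E) :
  filterlim c F (locally (k : C_AbsRing)) -> filterlim f F (locally l) ->
  filterlim (fun x => scal (c x) (f x) : E) F (locally (scal k l : E)).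
Proof.
intros Hc Hf; eapply filterlim_comp_2; [exact Hc|exact Hf|exact (filterlim_scal (V := E) (k : C_AbsRing) l)].
Qed.

End Realify.

Lemma C0_real_semigroup {E : CompleteNormedModule C_AbsRing} (T : R -> E -> E) :
  is_C0_semigroup T -> real_semigroup (V := realify E) T.
Proof.
intros HT; constructor.
- intros t Ht; apply realify_linear, (c0_linear _ HT t Ht).
- exact (c0_zero _ HT).
- exact (c0_plus _ HT).
- exact (c0_continuous _ HT).
Qed.

(** * Rescaled semigroups *)

(** This is e^(-lt), written by its real and imaginary parts. *)
Definition expneg (l : C) (t : R) : C :=
  (exp (- (Re l * t)) * cos (Im l * t), - (exp (- (Re l * t)) * sin (Im l * t))).

Lemma expneg_0 (l : C) : expneg l 0 = RtoC 1.
Proof.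
unfold expneg, RtoC; rewrite !Rmult_0_r, Ropp_0, exp_0, cos_0, sin_0; f_equal; ring.
Qed.

Lemma expneg_plus (l : C) (s t : R) :
  expneg l (s + t) = Cmult (expneg l s) (expneg l t).
Proof.
unfold expneg, Cmult; simpl.
rewrite !Rmult_plus_distr_l, cos_plus, sin_plus, Ropp_plus_distr, exp_plus.
f_equal; ring.
Qed.

Lemma expneg_opp (l : C) (t : R) : Cmult (expneg (Copp l) t) (expneg l t) = RtoC 1.
Proof.
destruct l as [a b]; unfold expneg, Cmult, RtoC, Copp; simpl.
rewrite !Ropp_mult_distr_l_reverse, cos_neg, sin_neg, Ropp_involutive, exp_Ropp.
assert (He := exp_pos (a * t)).
assert (H := sin2_cos2 (b * t)); unfold Rsqr in H.
f_equal; [|field; lra].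
transitivity (sin (b * t) * sin (b * t) + cos (b * t) * cos (b * t)); [field; lra|exact H].
Qed.

Lemma filterlim_C_components {T : Type} {F : (T -> Prop) -> Prop} {FF : Filter F}
    (c : T -> C) (k : C) :
  filterlim (fun x => Re (c x)) F (locally (Re k)) ->
  filterlim (fun x => Im (c x)) F (locally (Im k)) ->
  filterlim c F (locally (k : C_AbsRing)).
Proof.
intros Hr Hi; apply (filterlim_locally (U := AbsRing_UniformSpace C_AbsRing)); intros e.
assert (He : 0 < e / 2) by (assert (H := cond_pos e); lra).
assert (H1 := proj1 (filterlim_locally _ _) Hr (mkposreal _ He)).
assert (H2 := proj1 (filterlim_locally _ _) Hi (mkposreal _ He)).
generalize (filter_and _ _ H1 H2); apply filter_imp; intros x [Hx1 Hx2].
change (Rabs (Re (c x) - Re k) < e / 2) in Hx1.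
change (Rabs (Im (c x) - Im k) < e / 2) in Hx2.
change (Cmod (Cminus (c x) k) < e).
replace (Cminus (c x) k) with
  (Cplus (RtoC (Re (c x) - Re k)) (Cmult Ci (RtoC (Im (c x) - Im k)))).
  eapply Rle_lt_trans; [apply Cmod_triangle|].
  rewrite Cmod_mult, !Cmod_R.
  replace (Cmod Ci) with 1; [lra|].
  unfold Cmod, Ci; simpl; symmetry; transitivity (sqrt 1); [f_equal; ring|apply sqrt_1].
destruct (c x), k; unfold Cminus, Cplus, Cmult, Copp, RtoC, Ci; simpl; f_equal; ring.
Qed.

Lemma is_derive_lim_right (f : R -> R) (x l : R) :
  is_derive f x l ->
  filterlim (fun t => / t * (f (x + t) - f x)) (at_right 0) (locally l).
Proof.
intros H; apply is_derive_Reals in H.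
apply (filterlim_norm_iff (V := R_CompleteNormedModule) (F := at_right 0)); intros e He.
destruct (H e He) as [d Hd]; apply at_right_0_iff; exists d; split; [apply cond_pos|].
intros t Ht; change (Rabs (/ t * (f (x + t) - f x) - l) < e).
rewrite Rmult_comm; apply Hd; [lra|rewrite Rabs_pos_eq; lra].
Qed.

Lemma expneg_derive_0 (l : C) :
  filterlim (fun t => Cmult (RtoC (/ t)) (Cminus (expneg l t) (RtoC 1))) (at_right 0)
    (locally (Copp l : C_AbsRing)).
Proof.
apply filterlim_C_components.
- apply filterlim_ext with
    (fun t => / t * (Re (expneg l (0 + t)) - Re (expneg l 0))).
    intros t; rewrite expneg_0, Rplus_0_l; unfold Cmult, Cminus, Cplus, Copp, RtoC; simpl; ring.
  apply (is_derive_lim_right (fun t => Re (expneg l t))); unfold expneg; simpl.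
  auto_derive; [easy|]; rewrite !Rmult_0_r, Ropp_0, exp_0, cos_0, sin_0; unfold Re, Im; ring.
- apply filterlim_ext with
    (fun t => / t * (Im (expneg l (0 + t)) - Im (expneg l 0))).
    intros t; rewrite expneg_0, Rplus_0_l; unfold Cmult, Cminus, Cplus, Copp, RtoC; simpl; ring.
  apply (is_derive_lim_right (fun t => Im (expneg l t))); unfold expneg; simpl.
  auto_derive; [easy|]; rewrite !Rmult_0_r, Ropp_0, exp_0, cos_0, sin_0; unfold Re, Im; ring.
Qed.

Lemma expneg_continuous_0 (l : C) :
  filterlim (expneg l) (at_right 0) (locally (RtoC 1 : C_AbsRing)).
Proof.
assert (Hw : filterlim (fun t : R => t) (at_right 0) (locally 0)).
  intros P HP; now apply filter_le_within.
apply filterlim_C_components.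
- refine (filterlim_comp _ _ _ _ (fun t => Re (expneg l t)) _ _ _ Hw _).
  replace (Re 1) with (Re (expneg l 0)) by now rewrite expneg_0.
  apply (ex_derive_continuous (V := R_NormedModule)); unfold expneg; simpl; auto_derive; easy.
- refine (filterlim_comp _ _ _ _ (fun t => Im (expneg l t)) _ _ _ Hw _).
  replace (Im 1) with (Im (expneg l 0)) by now rewrite expneg_0.
  apply (ex_derive_continuous (V := R_NormedModule)); unfold expneg; simpl; auto_derive; easy.
Qed.

Section Rescale.
Context {E : CompleteNormedModule C_AbsRing}.

(** If A generates [T], then A - l generates this semigroup, so the resolvent of A at [l] becomes a
    resolvent at 0. *)
Definition rescale (l : C) (T : R -> E -> E) (t : R) (f : E) : E :=
  scal (expneg l t) (T t f).

Lemma rescale_C0 (l : C) (T : R -> E -> E) :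
  is_C0_semigroup T -> is_C0_semigroup (rescale l T).
Proof.
intros HT; constructor.
- intros t Ht; apply (is_linear_comp (T t)); [now apply (c0_linear _ HT)|apply scal_C_linear].
- intros f; unfold rescale; rewrite (c0_zero _ HT), expneg_0; exact (scal_one f).
- intros s t f Hs Ht; unfold rescale.
  rewrite (c0_plus _ HT), (linear_scal _ (c0_linear _ HT s Hs)), expneg_plus by easy.
  symmetry; exact (scal_assoc (expneg l s : C_AbsRing) (expneg l t) _).
- intros f; replace f with (scal (RtoC 1) f) at 1 by exact (scal_one f).
  apply (lim_scal_C E (F := at_right 0)); [apply expneg_continuous_0|apply (c0_continuous _ HT)].
Qed.

(** A product rule: the difference quotient splits into e^(-lt) times that of [T] plus that of
    e^(-lt) times [f]. *)
Lemma generator_rescale (l : C) (T : R -> E -> E) (f g : E) :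
  is_C0_semigroup T -> generator T f g ->
  generator (rescale l T) f (minus g (scal l f)).
Proof.
intros HT H; unfold generator.
apply filterlim_ext_loc with (fun t => plus
  (scal (expneg l t) (scal (RtoC (/ t)) (minus (T t f) f)) : E)
  (scal (Cmult (RtoC (/ t)) (Cminus (expneg l t) (RtoC 1))) f)).
  apply at_right_0_iff; exists 1; split; [lra|]; intros t Ht.
  unfold rescale, Cminus; cmodule_eq E.
replace (minus g (scal l f)) with (plus (scal (RtoC 1) g : E) (scal (Copp l) f))
  by (cmodule_eq E).
apply (lim_plus (V := realify E)).
- apply (lim_scal_C E (F := at_right 0)); [apply expneg_continuous_0|exact H].
- apply (lim_scal_C E (F := at_right 0)); [apply expneg_derive_0|apply filterlim_const].
Qed.

Lemma generator_rescale_inv (l : C) (T : R -> E -> E) (f g : E) :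
  is_C0_semigroup T -> generator (rescale l T) f g ->
  generator T f (plus g (scal l f)).
Proof.
intros HT H.
(* Rescaling again by [- l] restores [T]. *)
apply (generator_rescale (Copp l)) in H; [|now apply rescale_C0].
replace (plus g (scal l f)) with (minus g (scal (Copp l) f)) by (cmodule_eq E).
revert H; apply filterlim_ext; intros t; do 2 f_equal.
unfold rescale; transitivity (scal (Cmult (expneg (Copp l) t) (expneg l t)) (T t f) : E).
  exact (scal_assoc (expneg (Copp l) t : C_AbsRing) (expneg l t) _).
rewrite expneg_opp; exact (scal_one (T t f)).
Qed.

End Rescale.

(** * Resolvents *)

Section Resolvents.
Context {E : CompleteNormedModule C_AbsRing} (T : R -> E -> E).
Hypothesis HT : is_C0_semigroup T.

(** The form of [resolvent_set] in which the value of the generator at [S h] is solved for. *)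
Definition is_resolvent (l : C) (S : E -> E) : Prop :=
  is_linear S /\
  (forall h, generator T (S h) (minus (scal l (S h)) h)) /\
  (forall f g, generator T f g -> S (minus (scal l f) g) = f).

Lemma resolvent_set_iff (l : C) :
  resolvent_set (generator T) l <-> exists S, is_resolvent l S.
Proof.
split; intros (S & HS & H1 & H2); exists S; split; try easy; split; try easy; intros h.
- destruct (H1 h) as (g & Hg & Hh).
  replace (minus (scal l (S h)) h) with g; [easy|].
  transitivity (minus (scal l (S h)) (minus (scal l (S h)) g)); [cmodule_eq E|].
  now rewrite Hh.
- exists (minus (scal l (S h)) h); split; [easy|cmodule_eq E].
Qed.

Lemma generator_C_commutes (L : E -> E) (f g : E) :
  is_linear L -> (forall t x, 0 <= t -> L (T t x) = T t (L x)) ->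
  generator T f g -> generator T (L f) (L g).
Proof.
intros HL; apply (real_generator_commutes (V := realify E)); now apply realify_linear.
Qed.

(** The vector [T t (S f)] lies in the domain, and l - A sends it to [T t f]; applying [S] gives the
    claim. *)
Lemma resolvent_commutes (l : C) (S : E -> E) (t : R) (f : E) :
  is_resolvent l S -> 0 <= t -> S (T t f) = T t (S f).
Proof.
intros (_ & H1 & H2) Ht.
assert (HL := c0_linear _ HT t Ht).
assert (H : generator T (T t (S f)) (T t (minus (scal l (S f)) f))).
  apply (generator_C_commutes (T t)); [easy| |apply H1].
  intros s x Hs; rewrite <- !(c0_plus _ HT) by easy; now rewrite Rplus_comm.
apply H2 in H; rewrite <- H; f_equal.
rewrite (linear_minus _ _ _ HL), (linear_scal _ HL); cmodule_eq E.
Qed.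

Lemma laplace_resolvent (l : C) :
  (forall f, exists g : E, filterlim (fun tau => orbit_int (V := realify E) (rescale l T) tau f)
      (Rbar_locally p_infty) (locally g)) ->
  exists S, is_resolvent l S /\
    forall f, filterlim (fun tau => orbit_int (V := realify E) (rescale l T) tau f)
      (Rbar_locally p_infty) (locally (S f)).
Proof.
intros H.
assert (HU := rescale_C0 l T HT).
assert (HS : exists S : E -> E, @is_linear R_AbsRing (realify E) (realify E) S /\
    (forall f, filterlim (fun tau => orbit_int (V := realify E) (rescale l T) tau f)
      (Rbar_locally p_infty) (locally (S f))) /\
    (forall f, generator (rescale l T) (S f) (opp f)) /\
    (forall f g, generator (rescale l T) f g -> S g = opp f))
  by exact (laplace_inverse (V := realify E) _ (C0_real_semigroup _ HU) H).
destruct HS as (S & HS & HSlim & H1 & H2).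
exists S; split; [|exact HSlim].
assert (Hopp : forall x : E, S (opp x) = opp (S x)) by (intros x; exact (linear_opp (U := realify E) (V := realify E) S x HS)).
split; [|split].
- constructor; [exact (linear_plus (U := realify E) (V := realify E) S HS)| |exact (linear_norm (U := realify E) (V := realify E) S HS)].
  (* The real theory makes [S] only real linear. Complex homogeneity follows from the inverse
     property [H2]: the rescaled generator sends [scal c (S x)] to [opp (scal c x)]. *)
  intros c x; transitivity (opp (opp (S (scal c x)))); [cmodule_eq E|].
  transitivity (opp (opp (scal c (S x)))); [f_equal|cmodule_eq E].
  rewrite <- Hopp; apply (H2 (scal c (S x)) (opp (scal c x))).
  replace (opp (scal c x)) with (scal c (opp x) : E) by (cmodule_eq E).
  refine (real_generator_commutes (V := realify E) _ (fun y : E => scal c y : E) _ _ _ _ (H1 x)).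
    apply realify_linear, scal_C_linear.
  intros t y Ht; symmetry; exact (linear_scal _ (c0_linear _ HU t Ht) c y).
- intros h; replace (minus (scal l (S h)) h) with (plus (opp h) (scal l (S h)))
    by (cmodule_eq E).
  apply (generator_rescale_inv l T); [easy|exact (H1 h)].
- intros f g Hfg; apply (generator_rescale l) in Hfg; [|easy].
  apply H2 in Hfg.
  replace (minus (scal l f) g) with (opp (minus g (scal l f))) by (cmodule_eq E).
  rewrite Hopp; etransitivity; [apply f_equal; exact Hfg|exact (opp_opp f)].
Qed.

End Resolvents.

(** * Banach lattices *)

Section RealLattice.
Context {X : RealBanachLattice}.
Implicit Types x y v : X.

(* Transports [rbl_le] along equations whose sides match only up to conversion of
   the algebraic structures, where [rewrite] fails. *)
Lemma rbl_le_congr x y x' y' : rbl_le x y -> x = x' -> y = y' -> rbl_le x' y'.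
Proof. now intros H <- <-. Qed.

Lemma rbl_le_minus x y : rbl_le x y <-> rbl_le zero (minus y x).
Proof.
split; intros H.
- apply (rbl_le_plus X x y (opp x)) in H.
  refine (rbl_le_congr _ _ _ _ H _ _); module_eq X.
- apply (rbl_le_plus X _ _ x) in H.
  refine (rbl_le_congr _ _ _ _ H _ _); module_eq X.
Qed.

Lemma rbl_nonneg_plus x y : rbl_le zero x -> rbl_le zero y -> rbl_le zero (plus x y).
Proof.
intros Hx Hy; apply (rbl_le_trans X _ y); [easy|].
refine (rbl_le_congr _ _ _ _ (rbl_le_plus X _ _ y Hx) _ _); module_eq X.
Qed.

Lemma rbl_nonneg_scal (a : R) x : 0 <= a -> rbl_le zero x -> rbl_le zero (scal a x).
Proof.
intros Ha Hx; refine (rbl_le_congr _ _ _ _ (rbl_le_scal X a _ _ Ha Hx) _ _); module_eq X.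
Qed.

Lemma rbl_bounds_nonneg x v : rbl_le x v -> rbl_le (opp x) v -> rbl_le zero v.
Proof.
intros H1 H2; apply rbl_le_minus in H1; apply rbl_le_minus in H2.
replace v with (scal (/ 2) (plus (minus v x) (minus v (opp x)))) by (module_eq X; field).
apply rbl_nonneg_scal; [lra|now apply rbl_nonneg_plus].
Qed.

Lemma rbl_norm_bounds x v : rbl_le x v -> rbl_le (opp x) v -> norm x <= norm v.
Proof.
intros H1 H2; apply rbl_norm_le.
apply (rbl_le_trans X _ v); [now apply rbl_join_least|apply rbl_join_ub_l].
Qed.

Lemma rbl_opp_le x : rbl_le zero x -> rbl_le (opp x) zero.
Proof.
intros H; apply rbl_le_minus.
refine (rbl_le_congr _ _ _ _ H _ _); module_eq X.
Qed.

(* The negative part of [x] is dominated by [|x - y|] for every [y >= 0]. *)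
Lemma rbl_nonneg_approx x :
  (forall e, 0 < e -> exists y, rbl_le zero y /\ norm (minus y x) < e) -> rbl_le zero x.
Proof.
intros H; set (m := rbl_join (opp x) zero).
assert (Hm : rbl_le zero m) by apply rbl_join_ub_r.
assert (Hm0 : m = zero).
  apply (norm_eq_zero (V := X)), Rle_antisym; [|apply norm_ge_0].
  apply Rle_plus_epsilon; intros e He; destruct (H e He) as (y & Hy & Hyx).
  apply Rle_trans with (norm (minus y x)); [|lra].
  set (w := minus y x) in *; apply rbl_norm_le.
  apply (rbl_le_trans X _ m).
    apply rbl_join_least; [apply rbl_le_refl|].
    apply (rbl_le_trans X _ zero); [now apply rbl_opp_le|easy].
  apply rbl_join_least.
  - apply (rbl_le_trans X _ w); [|apply rbl_join_ub_l].
    apply rbl_le_minus; replace (minus w (opp x)) with y by (unfold w; module_eq X); easy.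
  - apply (rbl_bounds_nonneg w); [apply rbl_join_ub_l|apply rbl_join_ub_r].
assert (H1 : rbl_le (opp x) zero) by (rewrite <- Hm0; apply rbl_join_ub_l).
apply rbl_le_minus in H1.
refine (rbl_le_congr _ _ _ _ H1 _ _); module_eq X.
Qed.

End RealLattice.

Section ComplexLattice.
Context {E : ComplexBanachLattice}.
Implicit Types (x y : cbl_real E) (f g : E).

Definition cart x y : E := plus (cbl_emb x) (scal Ci (cbl_emb y)).

Lemma emb_zero : cbl_emb (zero : cbl_real E) = zero.
Proof.
replace (zero : cbl_real E) with (scal 0 (zero : cbl_real E)) by (module_eq (cbl_real E)).
rewrite cbl_emb_scal; cmodule_eq E.
Qed.

Lemma emb_cart x : cbl_emb x = cart x zero.
Proof. unfold cart; rewrite emb_zero; cmodule_eq E. Qed.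

Lemma emb_opp x : cbl_emb (opp x) = opp (cbl_emb x).
Proof.
replace (opp x) with (scal (-1) x) by module_eq (cbl_real E).
rewrite cbl_emb_scal; cmodule_eq E.
Qed.

Lemma emb_minus x y : cbl_emb (minus x y) = minus (cbl_emb x) (cbl_emb y).
Proof.
transitivity (plus (cbl_emb x) (cbl_emb (opp y))); [apply cbl_emb_plus|].
now rewrite emb_opp.
Qed.

Lemma cart_rotation_le x y (theta : R) :
  rbl_le (plus (scal (cos theta) x) (scal (sin theta) y)) (cbl_abs (cart x y)).
Proof. apply (proj1 (cbl_abs_sup E x y)); now exists theta. Qed.

(** The angles 0 and PI give x, -x <= |x + iy|. The angles PI/2 and -PI/2 do the same for [y] in the
    next lemma. *)
Lemma norm_cart_fst x y : norm x <= norm (cart x y).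
Proof.
rewrite cbl_norm_abs; apply rbl_norm_bounds.
- assert (H := cart_rotation_le x y 0); rewrite cos_0, sin_0 in H.
  refine (rbl_le_congr _ _ _ _ H _ _); module_eq (cbl_real E).
- assert (H := cart_rotation_le x y PI); rewrite cos_PI, sin_PI in H.
  refine (rbl_le_congr _ _ _ _ H _ _); module_eq (cbl_real E).
Qed.

Lemma norm_cart_snd x y : norm y <= norm (cart x y).
Proof.
rewrite cbl_norm_abs; apply rbl_norm_bounds.
- assert (H := cart_rotation_le x y (PI / 2)); rewrite cos_PI2, sin_PI2 in H.
  refine (rbl_le_congr _ _ _ _ H _ _); module_eq (cbl_real E).
- assert (H := cart_rotation_le x y (- (PI / 2))); rewrite cos_neg, sin_neg, cos_PI2, sin_PI2 in H.
  refine (rbl_le_congr _ _ _ _ H _ _); module_eq (cbl_real E).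
Qed.

Lemma norm_emb x : norm (cbl_emb x) = norm x.
Proof.
rewrite emb_cart; apply Rle_antisym; [|apply norm_cart_fst].
rewrite cbl_norm_abs; apply rbl_norm_le.
set (m := rbl_join x (opp x)).
assert (H1 : rbl_le x m) by apply rbl_join_ub_l.
assert (H2 : rbl_le (opp x) m) by apply rbl_join_ub_r.
assert (Hm := rbl_bounds_nonneg _ _ H1 H2).
apply rbl_join_least.
- apply (proj2 (cbl_abs_sup E x zero)); intros v (theta & ->).
  replace (plus (scal (cos theta) x) (scal (sin theta) zero)) with (scal (cos theta) x)
    by module_eq (cbl_real E).
  assert (Hc := COS_bound theta).
  apply rbl_le_minus in H1; apply rbl_le_minus in H2; apply rbl_le_minus.
  (* [m - cos theta x] is a convex combination of [m - x] and [m + x], both nonnegative. *)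
  refine (rbl_le_congr zero (plus (scal ((1 + cos theta) / 2) (minus m x))
    (scal ((1 - cos theta) / 2) (minus m (opp x)))) _ _ _ eq_refl _).
    apply rbl_nonneg_plus; apply rbl_nonneg_scal; try easy; lra.
  module_eq (cbl_real E); field.
(* The norm axiom compares absolute values, so the negative of the modulus must also lie below
   [m]. *)
- apply (rbl_le_trans _ _ zero); [|easy].
  apply rbl_opp_le, (rbl_bounds_nonneg x).
  + assert (H := cart_rotation_le x zero 0); rewrite cos_0, sin_0 in H.
    refine (rbl_le_congr _ _ _ _ H _ _); module_eq (cbl_real E).
  + assert (H := cart_rotation_le x zero PI); rewrite cos_PI, sin_PI in H.
    refine (rbl_le_congr _ _ _ _ H _ _); module_eq (cbl_real E).
Qed.

Lemma nonneg_zero : Defs.nonneg (zero : E).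
Proof. exists zero; split; [apply rbl_le_refl|symmetry; apply emb_zero]. Qed.

Lemma nonneg_plus f g : Defs.nonneg f -> Defs.nonneg g -> Defs.nonneg (plus f g).
Proof.
intros (x & Hx & ->) (y & Hy & ->); exists (plus x y); split.
  now apply rbl_nonneg_plus.
symmetry; apply cbl_emb_plus.
Qed.

Lemma nonneg_scal (a : R) f : 0 <= a -> Defs.nonneg f -> Defs.nonneg (scal (RtoC a) f : E).
Proof.
intros Ha (x & Hx & ->); exists (scal a x); split.
  now apply rbl_nonneg_scal.
symmetry; apply cbl_emb_scal.
Qed.

(** The two bounds force [f] and [g] to be real, as half the difference and half the sum of [g + f]
    and [g - f]; the real lattice norm then applies. *)
Lemma norm_le_of_bounds f g : Defs.nonneg (minus g f) -> Defs.nonneg (plus g f) -> norm f <= norm g.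
Proof.
intros (p & Hp & H1) (q & Hq & H2).
assert (Hg : g = cbl_emb (scal (/ 2) (plus p q))).
  rewrite cbl_emb_scal, cbl_emb_plus, <- H1, <- H2, RtoC_inv by lra; cmodule_eq E; field.
assert (Hf : f = cbl_emb (scal (/ 2) (minus q p))).
  rewrite cbl_emb_scal, emb_minus, <- H1, <- H2, RtoC_inv by lra; cmodule_eq E; field.
rewrite Hf, Hg, !norm_emb; apply rbl_norm_bounds; apply rbl_le_minus.
- match goal with |- rbl_le _ ?z => replace z with p by (module_eq (cbl_real E); field) end; easy.
- match goal with |- rbl_le _ ?z => replace z with q by (module_eq (cbl_real E); field) end; easy.
Qed.

(** Extends convergence of Laplace integrals from nonnegative vectors to all of [E]. *)
Lemma nonneg_decomposition f : exists f1 f2 f3 f4 : E,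
  Defs.nonneg f1 /\ Defs.nonneg f2 /\ Defs.nonneg f3 /\ Defs.nonneg f4 /\
  f = plus (minus f1 f2) (scal Ci (minus f3 f4)).
Proof.
assert (Hreal : forall x, exists p q, rbl_le zero p /\ rbl_le zero q /\ x = minus p q).
  intros x; exists (rbl_join x zero), (minus (rbl_join x zero) x); split; [apply rbl_join_ub_r|].
  split; [apply (proj1 (rbl_le_minus x _)), rbl_join_ub_l|module_eq (cbl_real E)].
destruct (cbl_decomp E f) as ([x y] & -> & _); simpl.
destruct (Hreal x) as (p & q & Hp & Hq & ->), (Hreal y) as (p' & q' & Hp' & Hq' & ->).
exists (cbl_emb p), (cbl_emb q), (cbl_emb p'), (cbl_emb q').
rewrite !emb_minus.
split; [now exists p|split; [now exists q|split; [now exists p'|split; [now exists q'|easy]]]].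
Qed.

(** The norm of the imaginary part of [f] is at most its distance to any nonnegative vector, so that
    part vanishes; closedness of the real cone settles the rest. *)
Lemma nonneg_approx f :
  (forall e, 0 < e -> exists g, Defs.nonneg g /\ norm (minus g f) < e) -> Defs.nonneg f.
Proof.
intros H; destruct (cbl_decomp E f) as ([x y] & Hf & _); simpl in Hf.
assert (Hy : y = zero).
  apply (norm_eq_zero (V := cbl_real E)), Rle_antisym; [|apply norm_ge_0].
  apply Rle_plus_epsilon; intros e He; destruct (H e He) as (g & (z & Hz & ->) & Hzf).
  replace (minus (cbl_emb z) f) with (cart (minus z x) (opp y)) in Hzf.
    assert (H1 : norm y <= norm (cart (minus z x) (opp y))); [|lra].
    eapply Rle_trans; [right; symmetry; exact (norm_opp y)|exact (norm_cart_snd _ _)].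
  unfold cart; rewrite Hf, emb_minus, emb_opp; cmodule_eq E.
exists x; split; [|rewrite Hf, Hy, emb_zero; cmodule_eq E].
apply rbl_nonneg_approx; intros e He; destruct (H e He) as (g & (z & Hz & ->) & Hzf).
exists z; split; [easy|].
replace (minus (cbl_emb z) f) with (cart (minus z x) (opp y)) in Hzf.
  assert (H1 := norm_cart_fst (minus z x) (opp y)); lra.
unfold cart; rewrite Hf, emb_minus, emb_opp; cmodule_eq E.
Qed.

Lemma lim_nonneg {A : Type} {F : (A -> Prop) -> Prop} {FF : ProperFilter F} (u : A -> E) f :
  filterlim u F (locally f) -> F (fun a => Defs.nonneg (u a)) -> Defs.nonneg f.
Proof.
intros Hu Hn; apply nonneg_approx; intros e He.
assert (H := proj1 (filterlim_norm_iff (V := realify E) u f) Hu e He).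
destruct (filter_ex _ (filter_and _ _ Hn H)) as (a & Ha & Hae).
now exists (u a).
Qed.

Lemma Riemann_sum_nonneg (u : R -> realify E) (ptd : SF_seq) :
  pointed_subdiv ptd -> (forall t, Defs.nonneg (u t : E)) ->
  Defs.nonneg (Riemann_sum u ptd : E).
Proof.
intros Hptd Hu; revert Hptd.
apply SF_cons_ind with (s := ptd); [intros x0 _; exact nonneg_zero|].
intros h0 s IH Hs; rewrite (Riemann_sum_cons (V := realify E)).
assert (Hs' := ptd_cons _ _ Hs).
destruct (Hs O) as [H1 H2]; [apply Nat.lt_0_succ|].
apply nonneg_plus; [|now apply IH].
apply (nonneg_scal (SF_h s - fst h0)); [|apply Hu].
assert (H := Rle_trans _ _ _ H1 H2); change (fst h0 <= SF_h s) in H; lra.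
Qed.

Lemma is_RInt_nonneg (u : R -> realify E) (a b : R) (l : realify E) :
  a <= b -> (forall t, a <= t <= b -> Defs.nonneg (u t : E)) -> is_RInt u a b l ->
  Defs.nonneg (l : E).
Proof.
intros Hab Hu Hl.
(* Clamping makes the integrand nonnegative on the whole line, so sample points need not be
   located. *)
set (c := fun t => u (Rmax a (Rmin b t))).
assert (Hc : is_RInt c a b l).
  apply is_RInt_ext with u; [|easy]; intros t; rewrite Rmin_left, Rmax_right by easy.
  intros Ht; unfold c; rewrite Rmin_right, Rmax_right by lra; easy.
apply (lim_nonneg (F := Riemann_fine a b) _ _ Hc).
(* Any mesh will do: every Riemann sum of [c] over a pointed subdivision of [a, b] is
   nonnegative. *)
exists (mkposreal 1 Rlt_0_1); intros ptd _ [Hptd _].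
apply (nonneg_scal (sign (b - a))); [apply sign_ge_0; lra|].
apply Riemann_sum_nonneg; [easy|]; intros t; apply Hu; split; [apply Rmax_l|].
apply Rmax_lub; [easy|apply Rmin_l].
Qed.

(** Positivity replaces absolute convergence: q u - w u and q u + w u are nonnegative, so the
    weighted integral lies between -q v and q v in the order. The bound involves the norm of the
    integral of [u], not the integral of its norm. *)
Lemma norm_is_RInt_weight (u : R -> realify E) (w : R -> R) (q a b : R) (v x : realify E) :
  a <= b -> (forall t, a <= t <= b -> Defs.nonneg (u t : E)) ->
  (forall t, a <= t <= b -> Rabs (w t) <= q) ->
  is_RInt u a b v -> is_RInt (fun t => scal (w t) (u t)) a b x ->
  norm x <= q * norm v.
Proof.
intros Hab Hu Hw Hv Hx.
assert (Hq : 0 <= q) by (apply Rle_trans with (Rabs (w a)); [apply Rabs_pos|apply Hw; lra]).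
apply Rle_trans with (norm (scal q v)); [|rewrite norm_scal_R, Rabs_pos_eq by easy; lra].
assert (Hqv := is_RInt_scal (V := realify E) _ _ _ q _ Hv).
apply (norm_le_of_bounds (x : E) (scal q v : realify E)).
- apply (is_RInt_nonneg (fun t => minus (scal q (u t)) (scal (w t) (u t))) a b _ Hab);
    [|exact (is_RInt_minus (V := realify E) _ _ _ _ _ _ Hqv Hx)].
  intros t Ht; specialize (Hw t Ht); apply Rabs_le_between in Hw.
  replace (minus (scal q (u t)) (scal (w t) (u t))) with (scal (q - w t) (u t))
    by module_eq (realify E).
  apply (nonneg_scal (q - w t)); [lra|now apply Hu].
- apply (is_RInt_nonneg (fun t => plus (scal q (u t)) (scal (w t) (u t))) a b _ Hab);
    [|exact (is_RInt_plus (V := realify E) _ _ _ _ _ _ Hqv Hx)].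
  intros t Ht; specialize (Hw t Ht); apply Rabs_le_between in Hw.
  replace (plus (scal q (u t)) (scal (w t) (u t))) with (scal (q + w t) (u t))
    by module_eq (realify E).
  apply (nonneg_scal (q + w t)); [lra|now apply Hu].
Qed.

End ComplexLattice.

(** * Laplace transforms *)

Definition laplace_int {E : CompleteNormedModule C_AbsRing} (T : R -> E -> E) (l : C)
    (tau : R) (f : E) : E := orbit_int (V := realify E) (rescale l T) tau f.

Definition laplace_cv {E : CompleteNormedModule C_AbsRing} (T : R -> E -> E) (l : C)
    (f : E) : Prop :=
  exists g : E, filterlim (fun tau => laplace_int T l tau f) (Rbar_locally p_infty) (locally g).

Section Laplace.
Context {E : CompleteNormedModule C_AbsRing} (T : R -> E -> E).
Hypothesis HT : is_C0_semigroup T.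

Let HU (l : C) : real_semigroup (V := realify E) (rescale l T) :=
  C0_real_semigroup _ (rescale_C0 l T HT).

Lemma laplace_cv_of_tail (l : C) (f : E) (d K : R) : 0 < d ->
  (forall a b x, 0 <= a -> a <= b ->
    is_RInt (V := realify E) (orbit (V := realify E) (rescale l T) f) a b x ->
    norm (x : E) <= K * exp (- (d * a))) ->
  laplace_cv T l f.
Proof.
intros Hd0 H.
assert (Hd : forall a b, 0 <= a -> a <= b ->
    norm (minus (laplace_int T l b f) (laplace_int T l a f)) <= K * exp (- (d * a))).
  intros a b Ha Hab.
  apply (H a b); [easy|easy|].
  assert (H0 := RInt_correct (V := realify E) _ _ _ (orbit_ex_RInt _ (HU l) f a b)).
  assert (Heq : minus (laplace_int T l b f) (laplace_int T l a f) =
    RInt (V := realify E) (orbit (V := realify E) (rescale l T) f) a b).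
    unfold laplace_int, orbit_int.
    rewrite <- (RInt_Chasles (V := realify E) _ 0 a b) by apply (orbit_ex_RInt _ (HU l)).
    module_eq (realify E).
  rewrite Heq; exact H0.
apply (lim_cauchy (V := realify E)); intros e He.
(* From [A] on, e^(-da) is at most [e / (Rabs K + 1)], which brings the tail bound below [e]. *)
set (A := Rmax 0 (- ln (e / (Rabs K + 1)) / d)).
assert (HK := Rabs_pos K); assert (HK' := Rle_abs K).
exists (fun tau => A <= tau); split; [exists A; intros; lra|].
assert (He' : 0 < e / (Rabs K + 1)) by (apply Rdiv_lt_0_compat; lra).
assert (Hsmall : forall a, A <= a -> K * exp (- (d * a)) < e).
  intros a Ha.
  assert (Hexp : exp (- (d * a)) <= e / (Rabs K + 1)).
    rewrite <- (exp_ln (e / (Rabs K + 1))) by easy.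
    assert (Hle : - (d * a) <= ln (e / (Rabs K + 1))).
      assert (H1 : - ln (e / (Rabs K + 1)) / d <= a) by (apply Rle_trans with A; [apply Rmax_r|easy]).
      apply (Rmult_le_compat_l d) in H1; [|lra].
      replace (d * (- ln (e / (Rabs K + 1)) / d)) with (- ln (e / (Rabs K + 1))) in H1
        by (field; lra); lra.
    destruct Hle as [Hlt|Heq]; [left; now apply exp_increasing|rewrite Heq; lra].
  assert (Hp := exp_pos (- (d * a))).
  apply Rle_lt_trans with (Rabs K * exp (- (d * a))); [apply Rmult_le_compat_r; lra|].
  apply Rle_lt_trans with (Rabs K * (e / (Rabs K + 1))); [apply Rmult_le_compat_l; lra|].
  apply Rlt_le_trans with ((Rabs K + 1) * (e / (Rabs K + 1))); [apply Rmult_lt_compat_r; lra|].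
  right; field; lra.
assert (HA : 0 <= A) by apply Rmax_l.
intros u v Hu Hv; destruct (Rle_lt_dec u v) as [Huv|Huv].
- rewrite norm_minus_sym; eapply Rle_lt_trans; [apply Hd; lra|now apply Hsmall].
- eapply Rle_lt_trans; [apply Hd; lra|now apply Hsmall].
Qed.

Lemma laplace_cv_plus (l : C) (f g : E) :
  laplace_cv T l f -> laplace_cv T l g -> laplace_cv T l (plus f g).
Proof.
intros [f' Hf] [g' Hg]; exists (plus f' g').
apply filterlim_ext_loc with (fun tau => plus (laplace_int T l tau f) (laplace_int T l tau g)).
  exists 0; intros tau Htau; symmetry.
  exact (linear_plus _ (orbit_int_linear _ (HU l) tau (Rlt_le _ _ Htau)) f g).
now apply (lim_plus (V := realify E)).
Qed.

Lemma laplace_cv_scal (l c : C) (f : E) :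
  laplace_cv T l f -> laplace_cv T l (scal c f).
Proof.
intros [f' Hf]; exists (scal c f').
apply filterlim_ext_loc with (fun tau => scal c (laplace_int T l tau f) : E).
  exists 0; intros tau Htau; symmetry.
  apply (is_RInt_unique (V := realify E)).
  apply (is_RInt_ext (V := realify E)) with
    (fun t => scal c (orbit (V := realify E) (rescale l T) f t : E)).
    intros t _; symmetry.
    exact (linear_scal _ (c0_linear _ (rescale_C0 l T HT) _ (Rmax_l 0 t)) c f).
  apply (is_RInt_linear (V := realify E) (W := realify E) (fun y : E => scal c y : E)).
    apply realify_linear, scal_C_linear.
  apply (orbit_int_correct _ (HU l)).
apply (lim_linear (V := realify E) (W := realify E) (fun y : E => scal c y : E)); [|easy].
apply realify_linear, scal_C_linear.
Qed.

(** Splitting at [t0] leaves a fixed integral over the initial piece, plus the Laplace integral of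
    [T t0 f] up to [tau - t0], multiplied by e^(-l t0). *)
Lemma laplace_cv_shift (l : C) (f : E) (t0 : R) : 0 <= t0 ->
  laplace_cv T l (T t0 f) -> laplace_cv T l f.
Proof.
intros Ht0 H; apply (laplace_cv_scal l (expneg l t0)) in H; destruct H as [g Hg].
change (scal (expneg l t0) (T t0 f)) with (rescale l T t0 f) in Hg.
exists (plus (laplace_int T l t0 f) g).
apply filterlim_ext_loc with
  (fun tau => plus (laplace_int T l t0 f) (laplace_int T l (tau - t0) (rescale l T t0 f))).
  exists t0; intros tau Htau; unfold laplace_int.
  rewrite (orbit_int_commutes (V := realify E)), (orbit_int_shift (V := realify E))
    by (try apply HU; lra).
  replace (tau - t0 + t0) with tau by ring; module_eq (realify E).
apply (lim_plus (V := realify E)); [apply filterlim_const|].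
refine (filterlim_comp _ _ _ (fun tau => tau - t0)
  (fun tau => laplace_int T l tau (rescale l T t0 f)) _ _ _ _ Hg).
intros P [M HM]; exists (M + t0); intros x Hx; apply HM; lra.
Qed.

Lemma is_RInt_exp_neg (c a b : R) :
  is_RInt (fun t => c * exp (- t)) a b (c * exp (- a) - c * exp (- b)).
Proof.
replace (c * exp (- a) - c * exp (- b)) with (- c * exp (- b) - - c * exp (- a)) by ring.
apply (is_RInt_derive (V := R_CompleteNormedModule) (fun t => - c * exp (- t))).
- intros t _.
  assert (H : is_derive (fun u : R => - c * exp (- u)) t (c * exp (- t)));
    [auto_derive; [easy|ring]|exact H].
- intros t _; apply (ex_derive_continuous (V := R_NormedModule)); auto_derive; easy.
Qed.

Lemma Cmod_expneg (l : C) (t : R) : Cmod (expneg l t) = exp (- (Re l * t)).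
Proof.
unfold Cmod, expneg; simpl.
assert (H := sin2_cos2 (Im l * t)); unfold Rsqr in H.
assert (He := exp_pos (- (Re l * t))).
set (x := exp (- (Re l * t))) in *.
transitivity (sqrt (Rsqr x)); [|apply sqrt_Rsqr; lra].
f_equal; unfold Rsqr.
transitivity (x * x * (sin (Im l * t) * sin (Im l * t) + cos (Im l * t) * cos (Im l * t)));
  [ring|rewrite H; ring].
Qed.

Lemma laplace_cv_right_half_plane :
  exists r, forall f, laplace_cv T (RtoC r) f.
Proof.
destruct (real_semigroup_growth (V := realify E) _ (C0_real_semigroup _ HT))
  as (M & w & HM & Hw & Hb).
(* One more than the growth rate [w], so the integrand is bounded by [M * norm f * exp (- t)]. *)
exists (w + 1); intros f; apply (laplace_cv_of_tail _ _ 1 (M * norm f)); [lra|].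
intros a b x Ha Hab Hx; rewrite Rmult_1_l.
assert (H0 := norm_ge_0 f).
assert (Hc : 0 <= M * norm f) by (apply Rmult_le_pos; lra).
apply Rle_trans with (M * norm f * exp (- a) - M * norm f * exp (- b)).
  refine (norm_RInt_le (V := realify E) _ _ _ _ _ _ Hab _ Hx (is_RInt_exp_neg _ _ _)).
  intros t Ht; unfold orbit, rescale; rewrite Rmax_right by lra.
  eapply Rle_trans; [exact (norm_scal (V := E) (expneg (RtoC (w + 1)) t : C_AbsRing) (T t f))|].
  change (abs (expneg (RtoC (w + 1)) t : C_AbsRing)) with (Cmod (expneg (RtoC (w + 1)) t)).
  rewrite Cmod_expneg.
  apply Rle_trans with (exp (- (Re (RtoC (w + 1)) * t)) * (M * exp (w * t) * norm f)).
    apply Rmult_le_compat_l; [left; apply exp_pos|apply Hb; lra].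
  right; replace (- t) with (- (Re (RtoC (w + 1)) * t) + w * t) by (simpl; ring).
  rewrite exp_plus; ring.
assert (H1 := exp_pos (- b)).
assert (0 <= M * norm f * exp (- b)) by (apply Rmult_le_pos; lra).
lra.
Qed.

End Laplace.

(** * Eventual positivity *)

Section EventuallyPositive.
Context {E : ComplexBanachLattice} (T : R -> E -> E).
Hypothesis HT : is_C0_semigroup T.

Let HU (l : C) : real_semigroup (V := realify E) (rescale l T) :=
  C0_real_semigroup _ (rescale_C0 l T HT).

Definition orbit_pos (g : E) : Prop := forall t, 0 <= t -> Defs.nonneg (T t g).

Lemma orbit_pos_shift (g : E) (t : R) : 0 <= t -> orbit_pos g -> orbit_pos (T t g).
Proof. intros Ht Hg s Hs; rewrite <- (c0_plus _ HT) by easy; apply Hg; lra. Qed.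

Lemma orbit_pos_plus (f g : E) : orbit_pos f -> orbit_pos g -> orbit_pos (plus f g).
Proof.
intros Hf Hg t Ht; rewrite (linear_plus _ (c0_linear _ HT t Ht)).
apply nonneg_plus; auto.
Qed.

Lemma lim_orbit_pos {A : Type} {F : (A -> Prop) -> Prop} {FF : ProperFilter F}
    (u : A -> E) (f : E) :
  filterlim u F (locally f) -> (forall a, orbit_pos (u a)) -> orbit_pos f.
Proof.
intros Hu Hn t Ht; apply (lim_nonneg (fun a => T t (u a))).
  apply (lim_linear (V := realify E) (W := realify E) (T t)); [|easy].
  apply realify_linear, (c0_linear _ HT t Ht).
now apply filter_forall; intros a; apply Hn.
Qed.

Definition pos_resolvent (r : R) (S : E -> E) : Prop :=
  is_resolvent T (RtoC r) S /\ forall g, orbit_pos g -> Defs.nonneg (S g).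

Lemma expneg_real (r t : R) : expneg (RtoC r) t = RtoC (exp (- (r * t))).
Proof. unfold expneg, RtoC; simpl; rewrite Rmult_0_l, cos_0, sin_0; f_equal; ring. Qed.

Lemma real_orbit_nonneg (r t : R) (g : E) : orbit_pos g ->
  Defs.nonneg (orbit (V := realify E) (rescale (RtoC r) T) g t : E).
Proof.
intros Hg; unfold orbit, rescale; rewrite expneg_real.
apply (nonneg_scal (exp (- (r * Rmax 0 t)))); [left; apply exp_pos|apply Hg, Rmax_l].
Qed.

Lemma pos_resolvent_of_laplace_cv (r : R) :
  (forall f, laplace_cv T (RtoC r) f) -> exists S, pos_resolvent r S.
Proof.
intros H; destruct (laplace_resolvent T HT (RtoC r) H) as (S & HS & Hlim).
exists S; split; [easy|]; intros g Hg.
apply (lim_nonneg (F := Rbar_locally p_infty) _ _ (Hlim g)).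
exists 0; intros tau Htau.
refine (is_RInt_nonneg (orbit (V := realify E) (rescale (RtoC r) T) g) 0 tau _ _ _ _).
- lra.
- intros t _; now apply real_orbit_nonneg.
- apply (orbit_int_correct _ (HU (RtoC r))).
Qed.

(* The difference is [e^(-rb) S (T b g)]: apply [S] to
   [(r - A) int_0^b e^(-rt) T t g dt = g - e^(-rb) T b g]. *)
Lemma laplace_int_le (r b : R) (S : E -> E) (g : E) :
  pos_resolvent r S -> orbit_pos g -> 0 <= b ->
  Defs.nonneg (minus (S g) (laplace_int T (RtoC r) b g)).
Proof.
intros ((HS & H1 & H2) & Hpos) Hg Hb.
assert (H : generator (rescale (RtoC r) T) (laplace_int T (RtoC r) b g)
    (minus (rescale (RtoC r) T b g) g))
  by exact (orbit_int_generator (V := realify E) _ (HU (RtoC r)) g b Hb).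
apply (generator_rescale_inv _ _ _ _ HT) in H; apply H2 in H.
assert (Heq : minus (S g) (laplace_int T (RtoC r) b g) = scal (RtoC (exp (- (r * b)))) (S (T b g))).
  rewrite <- H at 1; rewrite <- (linear_minus _ _ _ HS), <- (linear_scal _ HS); f_equal.
  rewrite <- expneg_real; unfold rescale; cmodule_eq E.
rewrite Heq; apply nonneg_scal; [left; apply exp_pos|].
apply Hpos; now apply orbit_pos_shift.
Qed.

(* On [a, b], [e^(-lt) T t g = (w1 t + i w2 t) e^(-rt) T t g] with
   [|w1|, |w2| <= e^(-(Re l - r) a)], and [int_a^b e^(-rt) T t g dt <= S g]. *)
Lemma laplace_cv_of_pos_resolvent (r : R) (S : E -> E) (l : C) (g : E) :
  pos_resolvent r S -> r < Re l -> orbit_pos g -> laplace_cv T l g.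
Proof.
intros HS Hl Hg.
set (o := orbit (V := realify E) (rescale (RtoC r) T) g).
(* The factor 2 counts one [norm (S g)] for each of the two real weights. *)
apply (laplace_cv_of_tail _ HT _ _ (Re l - r) (2 * norm (S g))); [lra|].
intros a b x Ha Hab Hx.
assert (Ho : forall t, Defs.nonneg (o t : E)) by (intros t; now apply real_orbit_nonneg).
assert (Hint := orbit_ex_RInt (V := realify E) _ (HU (RtoC r)) g).
destruct (Hint a b) as [v Hv].
assert (Hcont := orbit_continuous (V := realify E) _ (HU (RtoC r)) g).
assert (Hw : forall w : R -> R, (forall t, continuous w t) ->
    (forall t, a <= t <= b -> Rabs (w t) <= exp (- ((Re l - r) * a))) ->
    exists y, is_RInt (V := realify E) (fun t => scal (w t) (o t)) a b y /\
      norm (y : realify E) <= exp (- ((Re l - r) * a)) * norm (S g)).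
  intros w Hwc Hwb.
  destruct (ex_RInt_continuous (V := realify E) (fun t => scal (w t) (o t)) a b) as [y Hy].
    intros t _; apply (continuous_scal (V := realify E) w o); [apply Hwc|apply Hcont].
  exists y; split; [exact Hy|].
  eapply Rle_trans; [exact (norm_is_RInt_weight o w _ a b v y Hab (fun t _ => Ho t) Hwb Hv Hy)|].
  apply Rmult_le_compat_l; [left; apply exp_pos|].
  (* The comparison with [S g] is known on [0, b]; the nonnegative integral [v0] over [0, a] is
     discarded to obtain v <= S g. *)
  destruct (Hint 0 a) as [v0 Hv0].
  assert (Hv1 := is_RInt_Chasles (V := realify E) _ _ _ _ _ _ Hv0 Hv).
  assert (Hle := laplace_int_le r b S g HS Hg (Rle_trans _ _ _ Ha Hab)).
  apply (is_RInt_unique (V := realify E)) in Hv1.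
  change (laplace_int T (RtoC r) b g) with
    (RInt (V := realify E) (orbit (V := realify E) (rescale (RtoC r) T) g) 0 b) in Hle.
  rewrite Hv1 in Hle.
  assert (N0 : Defs.nonneg (v0 : E)) by exact (is_RInt_nonneg o 0 a v0 Ha (fun t _ => Ho t) Hv0).
  assert (N1 : Defs.nonneg (v : E)) by exact (is_RInt_nonneg o a b v Hab (fun t _ => Ho t) Hv).
  assert (N2 : Defs.nonneg (minus (S g) (v : E))).
    assert (N3 := nonneg_plus _ _ Hle N0).
    match type of N3 with Defs.nonneg ?z => replace (minus (S g) (v : E)) with z; [exact N3|] end.
    module_eq (realify E).
  apply norm_le_of_bounds; [exact N2|].
  assert (N3 := nonneg_plus _ _ (nonneg_plus _ _ N2 N1) N1).
  match type of N3 with Defs.nonneg ?z => replace (plus (S g) (v : E)) with z; [exact N3|] end.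
  module_eq (realify E).
set (q := fun t => exp (- ((Re l - r) * t))).
assert (Hq : forall t, a <= t <= b -> q t <= q a).
  intros t Ht; unfold q.
  assert (Hle : - ((Re l - r) * t) <= - ((Re l - r) * a)).
    apply Ropp_le_contravar, Rmult_le_compat_l; lra.
  destruct Hle as [Hlt|Heq]; [left; now apply exp_increasing|rewrite Heq; lra].
assert (Hq0 : forall t, 0 < q t) by (intros t; apply exp_pos).
assert (Hbound : forall t u, a <= t <= b -> -1 <= u <= 1 -> Rabs (q t * u) <= q a).
  intros t u Ht Hu; rewrite Rabs_mult, (Rabs_pos_eq (q t)) by (left; apply Hq0).
  rewrite <- (Rmult_1_r (q a)); apply Rmult_le_compat;
    [left; apply Hq0|apply Rabs_pos|now apply Hq|apply Rabs_le; lra].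
destruct (Hw (fun t => q t * cos (Im l * t))) as (y1 & Hy1 & Hn1).
- intros t; apply (ex_derive_continuous (V := R_NormedModule)); unfold q; auto_derive; easy.
- intros t Ht; apply Hbound; [easy|apply COS_bound].
- destruct (Hw (fun t => - (q t * sin (Im l * t)))) as (y2 & Hy2 & Hn2).
  + intros t; apply (ex_derive_continuous (V := R_NormedModule)); unfold q; auto_derive; easy.
  + intros t Ht; rewrite Rabs_Ropp; apply Hbound; [easy|apply SIN_bound].
  + assert (HiC := is_RInt_linear (V := realify E) (W := realify E) (fun y : E => scal Ci y : E)
      _ _ _ _ (realify_linear _ _ (scal_C_linear _ Ci)) Hy2).
    assert (Hsum := is_RInt_plus (V := realify E) _ _ _ _ _ _ Hy1 HiC).
    assert (Hx' : x = plus (y1 : E) (scal Ci (y2 : E))).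
      rewrite <- (is_RInt_unique (V := realify E) _ _ _ _ Hx).
      apply (is_RInt_unique (V := realify E)).
      revert Hsum; apply (is_RInt_ext (V := realify E)).
      intros t Ht; rewrite Rmin_left in Ht by easy.
      unfold o, orbit, rescale; rewrite Rmax_right, expneg_real by lra.
      assert (He : expneg l t = Cmult (Cplus (RtoC (q t * cos (Im l * t)))
          (Cmult Ci (RtoC (- (q t * sin (Im l * t)))))) (RtoC (exp (- (r * t))))).
        unfold expneg, q, Cmult, Cplus, RtoC, Ci; simpl.
        replace (- (fst l * t)) with (- ((fst l - r) * t) + - (r * t)) by ring.
        unfold Re, Im; replace (- (fst l * t)) with (- ((fst l - r) * t) + - (r * t)) by ring.
        rewrite exp_plus; f_equal; ring.
      rewrite He.
      change (plus (scal (RtoC (q t * cos (Im l * t))) (scal (RtoC (exp (- (r * t)))) (T t g)) : E)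
        (scal Ci (scal (RtoC (- (q t * sin (Im l * t)))) (scal (RtoC (exp (- (r * t)))) (T t g))))
        = scal (Cmult (Cplus (RtoC (q t * cos (Im l * t)))
          (Cmult Ci (RtoC (- (q t * sin (Im l * t)))))) (RtoC (exp (- (r * t))))) (T t g)).
      cmodule_eq E.
    rewrite Hx'.
    eapply Rle_trans; [exact (norm_triangle (V := E) _ _)|].
    assert (Hci : norm (scal Ci (y2 : E) : E) <= norm (y2 : E)).
      eapply Rle_trans; [exact (norm_scal (V := E) (Ci : C_AbsRing) y2)|].
      change (abs (Ci : C_AbsRing)) with (Cmod Ci).
      replace (Cmod Ci) with 1; [lra|].
      unfold Cmod, Ci; simpl; symmetry; transitivity (sqrt 1); [f_equal; ring|apply sqrt_1].
    change (norm (y1 : realify E)) with (norm (y1 : E)) in Hn1.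
    change (norm (y2 : realify E)) with (norm (y2 : E)) in Hn2.
    lra.
Qed.

Hypothesis Hpos : individually_eventually_positive T.

Lemma half_plane_of_pos_resolvent (r : R) (S : E -> E) (l : C) :
  pos_resolvent r S -> r < Re l -> resolvent_set (generator T) l.
Proof.
intros HS Hl; apply resolvent_set_iff.
destruct (laplace_resolvent T HT l) as (S' & HS' & _); [|now exists S'].
intros f.
assert (Hn : forall f, Defs.nonneg f -> laplace_cv T l f).
  intros g Hg; destruct (Hpos g Hg) as (t0 & Ht0 & Hg0).
  apply (laplace_cv_shift T HT l g t0 Ht0).
  apply (laplace_cv_of_pos_resolvent r S); [easy|easy|].
  intros t Ht; rewrite <- (c0_plus _ HT) by easy; apply Hg0; lra.
destruct (nonneg_decomposition f) as (f1 & f2 & f3 & f4 & H1 & H2 & H3 & H4 & ->).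
assert (Hd : forall u v, Defs.nonneg u -> Defs.nonneg v -> laplace_cv T l (minus u v)).
  intros u v Hu Hv; replace (minus u v) with (plus u (scal (Copp 1) v : E)) by (cmodule_eq E).
  apply laplace_cv_plus; [easy|now apply Hn|apply laplace_cv_scal; [easy|now apply Hn]].
apply laplace_cv_plus; [easy|now apply Hd|apply laplace_cv_scal; [easy|now apply Hd]].
Qed.

Lemma pos_resolvent_exists : exists r S, pos_resolvent r S.
Proof.
destruct (laplace_cv_right_half_plane T HT) as [r Hr].
exists r; now apply pos_resolvent_of_laplace_cv.
Qed.

(** The solution is the Neumann series of (1 - B)^(-1) applied to [x], obtained as the limit of its
    partial sums [u]. Each of them is built from [x] by sums and [B], so a closed property stable
    under both passes to [y]; it is used with [orbit_pos]. *)
Lemma neumann_solution (B : E -> E) (Q : E -> Prop) (x : E) :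
  is_linear B -> (forall y, norm (B y) <= / 2 * norm y) ->
  (forall y z, Q y -> Q z -> Q (plus y z)) -> (forall y, Q y -> Q (B y)) ->
  (forall (u : nat -> E) y, filterlim u eventually (locally y) -> (forall n, Q (u n)) -> Q y) ->
  exists y, y = plus x (B y) /\ (Q x -> Q y).
Proof.
intros HB HBn Qp QB Ql.
set (u := fix u n := match n with O => x | S n => plus x (B (u n)) end).
assert (Hu2 : forall n, norm (u n) <= 2 * norm x).
  assert (H0 := norm_ge_0 x); induction n as [|n IH]; simpl; [lra|].
  eapply Rle_trans; [exact (norm_triangle (V := E) _ _)|].
  specialize (HBn (u n)); lra.
(* The difference is B^n applied to [u k - x], and [u k - x] is 0 or [B (u (k - 1))], of norm at
   most [norm x]. *)
assert (Hud : forall n k, norm (minus (u (n + k)%nat) (u n) : E) <= (/ 2) ^ n * norm x).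
  induction n as [|n IH]; intros k; simpl.
    destruct k as [|k]; simpl.
      eapply Rle_trans; [right; exact (norm_minus_self (V := realify E) x)|].
      assert (H0 := norm_ge_0 x); lra.
    replace (minus (plus x (B (u k))) x) with (B (u k)) by (cmodule_eq E).
    specialize (HBn (u k)); specialize (Hu2 k); lra.
  replace (minus (plus x (B (u (n + k)%nat))) (plus x (B (u n))))
    with (B (minus (u (n + k)%nat) (u n))).
    eapply Rle_trans; [apply HBn|]; specialize (IH k); lra.
  rewrite (linear_minus _ _ _ HB); cmodule_eq E.
destruct (lim_cauchy (V := realify E) (F := eventually) u) as [y Hy].
  intros e He.
  assert (Hx := norm_ge_0 x).
  destruct (pow_lt_1_zero (/ 2)) with (y := e / 2 / (norm x + 1)) as [N HN].
    rewrite Rabs_pos_eq; lra.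
    apply Rdiv_lt_0_compat; lra.
  specialize (HN N (Nat.le_refl N)).
  assert (Hp : 0 < (/ 2) ^ N) by (apply pow_lt; lra).
  rewrite Rabs_pos_eq in HN by lra.
  assert (HNx : (/ 2) ^ N * norm x < e / 2).
    apply Rle_lt_trans with ((/ 2) ^ N * (norm x + 1)); [apply Rmult_le_compat_l; lra|].
    apply Rlt_le_trans with (e / 2 / (norm x + 1) * (norm x + 1)).
      apply Rmult_lt_compat_r; lra.
    right; field; lra.
  exists (fun n => (N <= n)%nat); split; [now exists N|].
  intros m n Hm Hn.
  assert (H1 := Hud N (m - N)%nat); assert (H2 := Hud N (n - N)%nat).
  replace (N + (m - N))%nat with m in H1 by lia.
  replace (N + (n - N))%nat with n in H2 by lia.
  eapply Rle_lt_trans; [exact (norm_minus_triangle (V := realify E) (u m) (u n) (u N))|].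
  change (norm (minus (u m) (u N) : E) + norm (minus (u n) (u N) : E) < e); lra.
exists y; split.
- apply (lim_unique (V := realify E) (F := eventually) (fun n => u (S n))).
    intros P HP; destruct (Hy P HP) as [N HN]; exists N; intros n Hn; apply HN; lia.
  simpl; apply (lim_plus (V := realify E)); [apply filterlim_const|].
  apply (lim_linear (V := realify E) (W := realify E) B); [now apply realify_linear|exact Hy].
- intros HQ; apply (Ql u y Hy); induction n as [|n IH]; simpl; [easy|].
  apply Qp; [easy|now apply QB].
Qed.

(** R(r - h) is R(r) composed with (1 - h R(r))^(-1). Below, [B] is h R(r) and [N] is the inverse of
    1 - B. *)
Lemma pos_resolvent_step (r h M : R) (S : E -> E) :
  pos_resolvent r S -> (forall x, norm (S x) <= M * norm x) -> 0 <= h -> h * M <= / 2 ->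
  exists S', pos_resolvent (r - h) S'.
Proof.
intros ((HS & H1 & H2) & HSpos) HM Hh HhM.
set (B := fun x => scal (RtoC h) (S x) : E).
assert (HB : is_linear B) by (apply (is_linear_comp S); [easy|apply scal_C_linear]).
assert (HBn : forall y, norm (B y) <= / 2 * norm y).
  intros y; unfold B; eapply Rle_trans; [exact (norm_scal (V := E) (RtoC h : C_AbsRing) (S y))|].
  change (abs (RtoC h : C_AbsRing)) with (Cmod (RtoC h)); rewrite Cmod_R, Rabs_pos_eq by easy.
  apply Rle_trans with (h * (M * norm y)); [now apply Rmult_le_compat_l|].
  rewrite <- Rmult_assoc; apply Rmult_le_compat_r; [apply norm_ge_0|easy].
assert (Hex : forall x, exists y, y = plus x (B y) /\ (orbit_pos x -> orbit_pos y)).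
  intros x; apply neumann_solution; try easy.
  - exact orbit_pos_plus.
  (* [S] is known to be nonnegative only on orbit-positive vectors. Since it commutes with [T t],
     [B y] has a nonnegative orbit again, which lets the iteration continue. *)
  - intros y Hy t Ht; unfold B.
    rewrite (linear_scal _ (c0_linear _ HT t Ht)).
    rewrite <- (resolvent_commutes T HT (RtoC r) S) by (try split; easy).
    apply nonneg_scal; [easy|]; apply HSpos; now apply orbit_pos_shift.
  - intros u y Hu Hn; exact (lim_orbit_pos u y Hu Hn).
set (N := fun x => proj1_sig (constructive_indefinite_description _ (Hex x))).
assert (HN : forall x, N x = plus x (B (N x)) /\ (orbit_pos x -> orbit_pos (N x))).
  intros x; exact (proj2_sig (constructive_indefinite_description _ (Hex x))).
clearbody N.
(* [B] contracts by one half, so the fixed point is unique. This yields both the linearity of [N]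
   and the left inverse property. *)
assert (Huniq : forall x y, y = plus x (B y) -> y = N x).
  intros x y Hy; destruct (HN x) as [Hx _].
  assert (Hd : minus y (N x) = B (minus y (N x))).
    rewrite (linear_minus _ _ _ HB).
    transitivity (minus (plus x (B y)) (plus x (B (N x)))); [now rewrite <- Hy, <- Hx|cmodule_eq E].
  assert (H0 : minus y (N x) = zero).
    apply (norm_eq_zero (V := E)), Rle_antisym; [|apply norm_ge_0].
    specialize (HBn (minus y (N x))); rewrite <- Hd in HBn; lra.
  transitivity (plus (minus y (N x)) (N x)); [cmodule_eq E|rewrite H0; cmodule_eq E].
assert (HNl : is_linear N).
  constructor.
  - intros x y; symmetry; apply Huniq.
    transitivity (plus (plus x (B (N x))) (plus y (B (N y)))).
      f_equal; apply HN.
    rewrite (linear_plus _ HB); cmodule_eq E.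
  - intros c x; symmetry; apply Huniq.
    transitivity (scal c (plus x (B (N x)))); [f_equal; apply HN|].
    rewrite (linear_scal _ HB); cmodule_eq E.
  - exists 2; split; [lra|]; intros x.
    assert (H : norm (N x) <= norm x + norm (B (N x))).
      rewrite (proj1 (HN x)) at 1; exact (norm_triangle (V := E) _ _).
    specialize (HBn (N x)); lra.
exists (fun x => S (N x)); split; [split; [|split]|].
- now apply (is_linear_comp N S).
- intros x; destruct (HN x) as [Hx _].
  replace (minus (scal (RtoC (r - h)) (S (N x))) x) with (minus (scal (RtoC r) (S (N x))) (N x)).
    apply H1.
  rewrite RtoC_minus.
  transitivity (minus (scal (RtoC r) (S (N x))) (plus x (B (N x)))); [now rewrite <- Hx|].
  unfold B; cmodule_eq E.
- intros f g Hfg; assert (Hz := H2 f g Hfg); set (z := minus (scal (RtoC r) f) g) in *.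
  (* Since [S z = f], z = ((r - h) f - g) + h f is the fixed point equation for (r - h) f - g. *)
  rewrite <- (Huniq _ z); [easy|].
  unfold B; rewrite Hz, RtoC_minus; unfold z; cmodule_eq E.
- intros g Hg; apply HSpos; now apply HN.
Qed.

(** If [p] had a resolvent [Sp] bounded by [M], then R(r) x = Sp (x - (r - p) R(r) x) would bound
    R(r) by 2M once r - p < 1/(4M). A step of length h = 1/(4M) satisfies h * 2M = 1/2 and ends
    strictly below [p]. *)
Lemma pos_resolvent_inf_spectrum (p : R) :
  (forall e, 0 < e -> exists r S, pos_resolvent r S /\ p <= r < p + e) ->
  (forall r S, pos_resolvent r S -> p <= r) ->
  spectrum (generator T) (RtoC p).
Proof.
intros Happ Hinf Hp; apply resolvent_set_iff in Hp.
destruct Hp as (Sp & HSp & _ & H2p).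
destruct (linear_norm _ HSp) as (M & HM & HMx).
assert (He : 0 < / (4 * M)) by (apply Rinv_0_lt_compat; lra).
destruct (Happ _ He) as (r & S & HS & Hr).
assert (HMr : (r - p) * M <= / 4).
  apply Rle_trans with (/ (4 * M) * M); [apply Rmult_le_compat_r; lra|right; field; lra].
assert (HSn : forall x, norm (S x) <= 2 * M * norm x).
  intros x; destruct HS as ((HS & H1 & H2) & _).
  assert (Hu := H2p _ _ (H1 x)).
  replace (minus (scal (RtoC p) (S x)) (minus (scal (RtoC r) (S x)) x))
    with (plus x (scal (RtoC (p - r)) (S x))) in Hu
    by (rewrite RtoC_minus; cmodule_eq E).
  assert (Hn := HMx (plus x (scal (RtoC (p - r)) (S x)))); rewrite Hu in Hn.
  assert (Hn2 : norm (plus x (scal (RtoC (p - r)) (S x)) : E) <= norm x + (r - p) * norm (S x)).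
    eapply Rle_trans; [exact (norm_triangle (V := E) _ _)|].
    apply Rplus_le_compat_l.
    eapply Rle_trans; [exact (norm_scal (V := E) (RtoC (p - r) : C_AbsRing) (S x))|].
    change (abs (RtoC (p - r) : C_AbsRing)) with (Cmod (RtoC (p - r))).
    rewrite Cmod_R, Rabs_minus_sym, Rabs_pos_eq; lra.
  assert (H0 := norm_ge_0 (S x)).
  assert (H3 : M * norm (plus x (scal (RtoC (p - r)) (S x)) : E) <=
    M * (norm x + (r - p) * norm (S x))) by (apply Rmult_le_compat_l; lra).
  assert (H4 : (r - p) * M * norm (S x) <= / 4 * norm (S x)) by (apply Rmult_le_compat_r; lra).
  assert (H5 := norm_ge_0 x).
  assert (H6 : 0 <= M * norm x) by (apply Rmult_le_pos; lra).
  lra.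
destruct (pos_resolvent_step r (/ (4 * M)) (2 * M) S HS HSn) as (S' & HS').
- lra.
- right; field; lra.
- specialize (Hinf _ _ HS'); lra.
Qed.

End EventuallyPositive.

Theorem theorem7p6 (E : ComplexBanachLattice) (T : R -> E -> E)
    (hT : is_C0_semigroup T)
    (hpos : individually_eventually_positive T)
    (hne : exists lambda : C, spectrum (generator T) lambda) :
  exists s : R,
    spectral_bound (generator T) = Finite s /\
    spectrum (generator T) (RtoC s).
Proof.
set (P := fun r => exists S, pos_resolvent T r S).
assert (Hright : forall r l, P r -> spectrum (generator T) l -> Re l <= r).
  intros r l [S HS] Hl; apply Rnot_lt_le; intros Hlt; apply Hl.
  now apply (half_plane_of_pos_resolvent T hT hpos r S).
destruct (pos_resolvent_exists T hT) as (r0 & S0 & HS0).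
assert (HP0 : P r0) by now exists S0.
destruct hne as [l0 Hl0].
(* [completeness] provides suprema, so it is applied to -P, and the infimum of P is [- m]. The
   spectral value [l0] makes -P bounded above. *)
destruct (completeness (fun x => P (- x))) as [m [Hm1 Hm2]].
- exists (- Re l0); intros x Hx; assert (H := Hright _ _ Hx Hl0); lra.
- exists (- r0); now rewrite Ropp_involutive.
- assert (Hinf : forall r, P r -> - m <= r).
    intros r Hr; assert (H : - r <= m) by (apply Hm1; now rewrite Ropp_involutive); lra.
  assert (Hs : spectrum (generator T) (RtoC (- m))).
    apply (pos_resolvent_inf_spectrum T hT).
    + intros e He; apply NNPP; intros Hno.
      (* If P had no point below [- m + e], then [m - e] would be an upper bound of -P. *)
      assert (m <= m - e); [|lra].
      apply Hm2; intros x Hx; destruct (Rle_lt_dec x (m - e)) as [Hle|Hlt]; [easy|].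
      destruct Hx as [S HS]; exfalso; apply Hno; exists (- x), S; split; [easy|].
      assert (H := Hinf (- x) (ex_intro _ S HS)); lra.
    + intros r S HS; apply Hinf; now exists S.
  exists (- m); split; [|easy].
  apply is_lub_Rbar_unique; split.
  + intros x (l & Hl & ->); simpl.
    apply Ropp_le_cancel; rewrite Ropp_involutive.
    apply Hm2; intros x Hx; assert (H := Hright _ _ Hx Hl); lra.
  + intros b Hb; apply Hb; exists (RtoC (- m)); now split.
Qed.
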